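(* Let $\epsilon>0$ be a constant, and consider Boolean functions $f\colon\{0,1\}^n\to\{0,1\}$ with $|f^{-1}(1)|\ge|f^{-1}(0)|$ (for the asymptotic items, a family $(f_n)_n$ of such functions). (1) If $f$ is a $(16,\,1.3(1-\epsilon)n,\,2^{\epsilon n})$-disperser, then $s(f)\ge 3.9(1-\epsilon)n-4$. (2) If for every constant integer $k$ and every constant $C>0$, $f_n$ is a $(k,\,Cn,\,2^{(1-\epsilon)n})$-disperser for all sufficiently large $n$ (i.e. $f$ is an $(\omega(1),O(n),2^{(1-\epsilon)n})$-disperser), then $s_{\mathrm{sp}}(f)=\omega(n)$. (3) If for every constant $\eta>0$, $f_n$ is a $(2^{(\log n)^{1-\eta}},\,\infty,\,2^{(1-\epsilon)n})$-disperser for all sufficiently large $n$ (i.e. $f$ is a $(2^{(\log n)^{1-o(1)}},\infty,2^{(1-\epsilon)n})$-disperser), then $s_{\log}(f)=\omega(n)$. (4) If for every constant $C>0$, $f_n$ is an $(n^{\epsilon},\,\infty,\,2^{n-Cn/\log\log n})$-disperser for all sufficiently large $n$ (i.e. $f$ is an $(n^\epsilon,\infty,2^{n-\omega(n/\log\log n)})$-disperser), then $s_{\log}(f)=\omega(n)$.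
   Context: A set $S\subseteq\{0,1\}^n$ is a $(d,m)$-variety if $S=\{x: p_1(x)=\dots=p_{m'}(x)=0\}$ for some $m'\le m$ polynomials $p_i$ over $\mathbb{F}_2$ of degree at most $d$; $m=\infty$ means no bound on the number of polynomials. $f$ is a $(d,m,s)$-disperser if $f$ is non-constant on every $(d,m)$-variety of size larger than $s$. Circuits are Boolean circuits over all binary Boolean operations (fan-in 2), with size = number of internal gates. $s(f)$ is the minimum size of a circuit computing $f$. $s_{\mathrm{sp}}(f)=\omega(n)$ means: for every constant $c$, for all large $n$, $f_n$ has no series-parallel circuit of size at most $cn$, where a circuit is series-parallel if its underlying DAG $(V,E)$ has a labeling $\ell\colon V\to\mathbb{N}$ with $\ell(u)<\ell(v)$ for every edge $(u,v)$ and with no two edges $(u,v),(u',v')$ satisfying $\ell(u)<\ell(u')<\ell(v)<\ell(v')$. $s_{\log}(f)=\omega(n)$ means: for every constant $c$, for all large $n$, $f_n$ has no circuit of size at most $cn$ and depth at most $c\log n$ (depth = maximum number of wires on an input-to-gate path). *)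

(* Defs.v *)
From HB Require Import structures.
From mathcomp Require Import all_boot all_order all_algebra.
From mathcomp Require Import all_classical all_reals all_analysis.
From mathcomp Require mpoly.
(* The notations of mpoly clash with those of MathComp-Analysis. *)
Import (canonicals, coercions) mpoly.
Set Implicit Arguments.
Unset Strict Implicit.
Unset Printing Implicit Defensive.
Import Order.TTheory GRing.Theory Num.Theory.
Local Open Scope classical_set_scope.
Local Open Scope ring_scope.

Definition cube (n : nat) : finType := {ffun 'I_n -> bool}.

Definition boolfun (n : nat) : Type := cube n -> bool.

Definition majority_one (n : nat) (f : boolfun n) : Prop :=
  (#|[set x : cube n | ~~ f x]%SET| <= #|[set x : cube n | f x]%SET|)%N.

Definition peval (n : nat) (p : mpoly.mpoly n 'F_2) (x : cube n) : 'F_2 :=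
  mpoly.meval (fun i : 'I_n => (x i : nat)%:R) p.

(* [mpoly.msize p] is the total degree plus one (and 0 for the zero polynomial).
   The degree bound may be any real number. *)
Definition degree_le (R : realType) (n : nat) (p : mpoly.mpoly n 'F_2) (d : R)
  : Prop := (mpoly.msize p).-1%:R <= d.

(* [m = +oo] puts no bound on the number of polynomials. *)
Definition is_variety (R : realType) (n : nat) (d : R) (m : \bar R)
    (S : {set cube n}) : Prop :=
  exists ps : seq (mpoly.mpoly n 'F_2),
    [/\ ((size ps)%:R%:E <= m)%E,
        (forall p, p \in ps -> degree_le p d) &
        S = [set x : cube n | all (fun p => peval p x == 0) ps]%SET].

Definition disperser (R : realType) (n : nat) (d : R) (m : \bar R) (s : R)
    (f : boolfun n) : Prop :=
  forall S : {set cube n}, is_variety d m S -> s < #|S|%:R ->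
    exists x y : cube n, [/\ x \in S, y \in S & f x != f y].

(* The nodes of a circuit are the input gates [inl i] and the internal gates
   [inr g]; [wire_rel i1 i2 u v] says that there is a wire from [u] to [v]. *)
Definition wire_rel (n s : nat) (i1 i2 : 'I_s -> 'I_n + 'I_s)
  : rel ('I_n + 'I_s)%type :=
  fun u v => if v is inr g then (u == i1 g) || (u == i2 g) else false.

Record circuit (n : nat) := Circuit {
  csize : nat;
  gate_op : 'I_csize -> bool -> bool -> bool;
  gate_in1 : 'I_csize -> 'I_n + 'I_csize;
  gate_in2 : 'I_csize -> 'I_n + 'I_csize;
  output : 'I_n + 'I_csize;
  circuit_acyclic : forall u v, wire_rel gate_in1 gate_in2 u v ->
    ~~ connect (wire_rel gate_in1 gate_in2) v u
}.

Definition node (n : nat) (C : circuit n) : finType := ('I_n + 'I_(csize C))%type.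

Definition wire (n : nat) (C : circuit n) : rel (node C) :=
  wire_rel (@gate_in1 n C) (@gate_in2 n C).

(* As the wires are acyclic, each [x] has exactly one such [val]. *)
Definition valuation (n : nat) (C : circuit n) (x : cube n)
    (val : node C -> bool) : Prop :=
  (forall i : 'I_n, val (inl i) = x i) /\
  (forall g : 'I_(csize C),
     val (inr g) = gate_op g (val (gate_in1 g)) (val (gate_in2 g))).

Definition computes (n : nat) (C : circuit n) (f : boolfun n) : Prop :=
  forall x : cube n, exists2 val : node C -> bool,
    valuation x val & val (output C) = f x.

(* For [n > 0] the infimum is a minimum. For [n = 0] there are no circuits,
   since there is nothing to feed a gate with, and the value is [+oo]. *)
Definition circuit_complexity (R : realType) (n : nat) (f : boolfun n)
  : \bar R :=
  ereal_inf [set (csize C)%:R%:E | C in [set C : circuit n | computes C f]].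

Definition series_parallel (n : nat) (C : circuit n) : Prop :=
  exists l : node C -> nat,
    (forall u v, wire u v -> (l u < l v)%N) /\
    ~ (exists u v u' v' : node C,
         [/\ wire u v, wire u' v' & [/\ l u < l u', l u' < l v & l v < l v']%N]).

(* In [path e u p], [size p] is the number of wires of the path. *)
Definition depth_le (R : realType) (n : nat) (C : circuit n) (D : R) : Prop :=
  forall (i : 'I_n) (p : seq (node C)),
    path (@wire n C) (inl i) p -> (size p)%:R <= D.

Definition sp_superlinear (R : realType) (f : forall n, boolfun n) : Prop :=
  forall c : R, \forall n \near \oo,
    ~ (exists C : circuit n,
         [/\ computes C (f n), series_parallel C & (csize C)%:R <= c * n%:R]).

Definition log2 (R : realType) (x : R) : R := ln x / ln 2.

Definition log_superlinear (R : realType) (f : forall n, boolfun n) : Prop :=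
  forall c : R, \forall n \near \oo,
    ~ (exists C : circuit n,
         [/\ computes C (f n), (csize C)%:R <= c * n%:R &
             depth_le C (c * log2 n%:R)]).

(* Main.v *)
(* If the values of a set [B] of nodes of a circuit are guessed so that every
   node has low degree as a polynomial in the inputs once the nodes of [B] are
   replaced by constants, then each guess cuts out a variety given by [#|B| + 1]
   low-degree equations on which the circuit outputs 1. The most popular guess
   gives a variety of size at least [2 ^ (n - 1 - #|B|)] on which [f] is
   constant, which a disperser forbids.

   In logarithmic depth, [B] is found by Valiant's removal of a block of binary
   digits from the depth labels.

   For series-parallel circuits, the wires are non-crossing arcs on a line. Rank
   each point by the number of distinct left ends of the arcs above it and by its
   position among the points below the same left ends, and symmetrically with
   right ends. Guessing the nodes where one of these four ranks is [i] modulo [K]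
   costs, for the best [i], a fraction [4 / K] of the nodes and leaves only paths
   of length bounded in terms of [K].

   For general circuits the guessed gates are chosen adaptively: at a gate of
   depth at most 4, so that the constraint has degree at most 16, a guess always
   eliminates 4 gates in both branches, or 3 gates in one and 5 in the other. *)

Require Import Defs.
From mathcomp Require Import all_boot all_order all_algebra.
From mathcomp Require Import all_classical all_reals all_analysis.
From mathcomp Require Import zify ring lra.
From mathcomp Require mpoly.
(* The notations of mpoly clash with those of MathComp-Analysis. *)
Import (canonicals, coercions) mpoly.
(* Gives the names of finset precedence over those of classical_sets. *)
From mathcomp.boot Require Import fintype finset.
Set Implicit Arguments.
Unset Strict Implicit.
Unset Printing Implicit Defensive.
Import Order.TTheory GRing.Theory Num.Theory.

(** * Non-crossing arcs *)

Lemma exists_le_average (K : nat) (c : 'I_K -> nat) :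
  0 < K -> exists i, K * c i <= \sum_i c i.
Proof.
move=> K0; case: (@arg_minnP _ (Ordinal K0) xpredT c isT) => i _ ci.
exists i; rewrite -{1}(card_ord K) -sum_nat_const.
by apply: leq_sum => j _; apply: ci.
Qed.

Section NonCrossing.

Variable N : nat.
Implicit Types (E : rel 'I_N) (u v w a b : 'I_N) (A : {set 'I_N}).

Definition noncrossing E :=
  (forall u v, E u v -> u < v) /\
  (forall a b u v, E a b -> E u v -> a < u -> u < b -> v <= b).

Definition left_ends E v : {set 'I_N} :=
  [set a : 'I_N | (a < v) && [exists b : 'I_N, (v < b) && E a b]].

Definition left_rank E v := #|left_ends E v|.

Definition sibling_rank E v :=
  #|[set y : 'I_N | (y < v) && (left_ends E y == left_ends E v)]|.

Lemma left_endsP E v a :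
  reflect (exists b, [/\ a < v, v < b & E a b]) (a \in left_ends E v).
Proof.
rewrite inE; apply: (iffP andP) => [[av /existsP[b /andP[vb Eab]]]|[b [av vb Eab]]].
  by exists b.
by split=> //; apply/existsP; exists b; rewrite vb.
Qed.

(** An arc over [v] that starts strictly between [u] and [v] would cross the arc from [u] to [v]. *)
Lemma left_ends_step E u v : noncrossing E -> E u v ->
  left_ends E v \subset u |: left_ends E u.
Proof.
move=> [Elt nc] Euv; apply/subsetP => a /left_endsP[b [av vb Eab]].
rewrite in_setU1; case: eqVneq => //= nau.
apply/left_endsP; exists b; split=> //; last exact: ltn_trans (Elt _ _ Euv) vb.
rewrite ltn_neqAle nau /= leqNgt; apply/negP => ua.
by have := nc _ _ _ _ Euv Eab ua av; rewrite leqNgt vb.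
Qed.

Lemma left_ends_trans E w v : noncrossing E -> w \in left_ends E v ->
  left_ends E w \subset left_ends E v.
Proof.
move=> [Elt nc] /left_endsP[b [wv vb Ewb]]; apply/subsetP => a.
move=> /left_endsP[c [aw wc Eac]]; apply/left_endsP; exists c; split=> //.
  exact: ltn_trans aw wv.
exact: leq_trans vb (nc _ _ _ _ Eac Ewb aw wc).
Qed.

(** Arcs over a common point are nested: an earlier left end reaches at least as far. So the left
    ends that survive an arc form an initial segment, in the order of positions, of those available
    at its start. *)
Lemma left_ends_init E u v a a' : noncrossing E -> E u v ->
  a' \in left_ends E v -> a \in u |: left_ends E u -> a < a' ->
  a \in left_ends E v.
Proof.
move=> ncE Euv a'v; have := subsetP (left_ends_step ncE Euv) _ a'v.
rewrite !in_setU1 => a'u au aa'.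
have lea'u : a' <= u.
  by case/orP: a'u => [/eqP->//|/left_endsP[? [/ltnW]]].
case/orP: au => [/eqP au|]; first by rewrite -au leqNgt aa' in lea'u.
move: a'v => /left_endsP[b' [a'v vb' Ea'b']] /left_endsP[b [au ub Eab]].
apply/left_endsP; exists b; split=> //; first exact: ltn_trans aa' a'v.
by apply: leq_trans vb' _; apply: ncE.2 Eab Ea'b' aa' (leq_ltn_trans lea'u ub).
Qed.

(** [u] is adjoined because it can itself be a left end over the next points of a path. *)
Definition initial_in E A u :=
  A \subset u |: left_ends E u /\
  (forall a a', a \in A -> a' \in u |: left_ends E u -> a' < a -> a' \in A).

(** By [left_ends_init] both sets are initial segments of the same chain, and of two such segments
    the one with no more elements is contained in the other. *)
Lemma initial_step E A u v : noncrossing E -> initial_in E A u -> E u v ->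
  #|A| <= left_rank E v -> A \subset left_ends E v /\ initial_in E A v.
Proof.
move=> ncE [/subsetP Au Ai] Euv cA.
have sub : A \subset left_ends E v.
  apply/subsetP => a aA; apply: contraLR cA => nav; rewrite -ltnNge.
  apply: (@leq_trans #|A :\ a|.+1); last by rewrite [leqRHS](cardsD1 a) aA.
  rewrite ltnS; apply: subset_leq_card; apply/subsetP => a' a'v.
  have a'u := subsetP (left_ends_step ncE Euv) _ a'v.
  have naa' : a' != a by apply: contraNneq nav => <-.
  rewrite in_setD1 naa' /=; apply: (Ai a) => //.
  rewrite ltn_neqAle naa' /= leqNgt; apply: contra nav => aa'.
  exact: left_ends_init a'v (Au _ aA) aa'.
split=> //; split; first by apply: subset_trans sub _; apply: subsetUr.
move=> a a' aA; rewrite in_setU1 => /orP[/eqP->|a'v] lt.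
  have /left_endsP[? [av _ _]] := subsetP sub _ aA.
  by have := ltn_trans lt av; rewrite ltnn.
by apply: Ai aA _ lt; apply: (subsetP (left_ends_step ncE Euv)).
Qed.

Lemma initial_path E A u p : noncrossing E -> initial_in E A u -> path E u p ->
  {in p, forall q, #|A| <= left_rank E q} ->
  {in p, forall q, A \subset left_ends E q}.
Proof.
move=> ncE; elim: p u => //= v p IHp u Au /andP[Euv pvp] cA.
have [Av iv] := initial_step ncE Au Euv (cA _ (mem_head _ _)).
move=> q; rewrite inE => /orP[/eqP->//|]; apply: IHp pvp _ _ => // r rp.
by apply: cA; rewrite inE rp orbT.
Qed.

Lemma path_left_ends E w p : noncrossing E -> path E w p ->
  {in p, forall q, left_rank E w <= left_rank E q} ->
  {in p, forall q, left_ends E w \subset left_ends E q}.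
Proof.
move=> ncE; apply: initial_path => //; split; first exact: subsetUr.
move=> a a' aw; rewrite in_setU1 => /orP[/eqP->|//].
by move: aw => /left_endsP[? [aw _ _]] /(ltn_trans aw); rewrite ltnn.
Qed.

(** Strictness leaves room for one more element, so [w] itself can join the initial segment that is
    carried along the path. *)
Lemma path_strict_left_ends E w p : noncrossing E -> path E w p ->
  {in p, forall q, left_rank E w < left_rank E q} ->
  {in p, forall q, w \in left_ends E q}.
Proof.
move=> ncE pwp cA q qp.
suff /subsetP sub : w |: left_ends E w \subset left_ends E q.
  by apply: sub; apply: setU11.
apply: (initial_path ncE _ pwp) qp; first by split.
move=> r rp; rewrite cardsU1; apply: leq_trans (cA r rp).
by case: (_ \notin _).
Qed.

Lemma path_hits_or_covers E w p (y : 'I_N) : noncrossing E -> path E w p -> w < y ->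
  y < last w p -> y \in p \/ exists2 q, q \in left_ends E y & w <= q.
Proof.
move=> ncE; elim: p w => [|v p IHp] w /=.
  by move=> _ /ltn_trans H /H; rewrite ltnn.
move=> /andP[Ewv pvp] wy yl; case: (ltngtP y v) => [yv|vy|/val_inj->].
- by right; exists w => //; apply/left_endsP; exists v.
- case: (IHp v pvp vy yl) => [yp|[q qy vq]]; first by left; rewrite inE yp orbT.
  by right; exists q => //; apply: leq_trans vq; apply/ltnW/ncE.1.
- by left; rewrite mem_head.
Qed.

Lemma path_last_ge E w p : noncrossing E -> path E w p -> w <= last w p.
Proof.
move=> [Elt _]; elim: p w => //= v p IHp w /andP[/Elt wv /IHp].
exact: leq_trans (ltnW wv).
Qed.

(* No point with the left ends of [w] can be jumped over, since the jump would
   start at a new left end; hence siblings are visited one after the other. *)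
Lemma sibling_rank_next E w p v : noncrossing E -> path E w (rcons p v) ->
  {in p, forall q, left_rank E w < left_rank E q} ->
  left_rank E v = left_rank E w ->
  sibling_rank E v = (sibling_rank E w).+1.
Proof.
move=> ncE pwv cp ev.
have wv : w < v.
  move: pwv; rewrite rcons_path => /andP[pw]; move/ncE.1.
  by apply: leq_ltn_trans; apply: path_last_ge pw.
have eqA : left_ends E v = left_ends E w.
  apply/esym/eqP; rewrite eqEcard -/(left_rank E v) ev leqnn andbT.
  apply: (path_left_ends ncE pwv); last by rewrite mem_rcons mem_head.
  move=> q; rewrite mem_rcons inE => /orP[/eqP->|/cp/ltnW//].
  by rewrite ev.
rewrite /sibling_rank eqA.
rewrite (_ : [set y : 'I_N | _] =
  w |: [set y : 'I_N | (y < w) && (left_ends E y == left_ends E w)]).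
  by rewrite cardsU1 inE ltnn.
apply/setP => y; rewrite in_setU1 !inE; case: (eqVneq y w) => [->|ney] /=.
  by rewrite wv eqxx.
case: (eqVneq (left_ends E y)) => [eqy|]; rewrite ?andbF ?andbT //.
apply/idP/idP => [yv|yw]; last exact: ltn_trans yw wv.
rewrite ltn_neqAle ney leqNgt; apply/negP => wy.
have : y < last w (rcons p v) by rewrite last_rcons.
case/(path_hits_or_covers ncE pwv wy); last first.
  move=> [q]; rewrite eqy => /left_endsP[? [qw _ _]].
  by move/(leq_trans qw); rewrite ltnn.
rewrite mem_rcons inE => /orP[/eqP yv'|/cp]; first by rewrite yv' ltnn in yv.
by rewrite /left_rank eqy ltnn.
Qed.

(** [h] is the distance from the lowest left rank of a path to the next forbidden one. At most [K]
    times the path makes an excursion to higher ranks; the [2] counts the arcs into and out of an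
    excursion. *)
Fixpoint tail_bound (K h : nat) : nat :=
  if h is h'.+1 then K * (tail_bound K h' + 2) else 0.

Definition left_bad E K i v :=
  (left_rank E v %% K == i) || (sibling_rank E v %% K == i).

Lemma modn_shift K i m : i < K -> exists2 h, h < K & (m + h) %% K = i.
Proof.
move=> iK; have K0 : 0 < K by exact: leq_ltn_trans iK.
exists ((i + (K - m %% K)) %% K); first by rewrite ltn_mod.
rewrite modnDmr -modnDml addnCA subnKC; last by rewrite ltnW // ltn_mod.
by rewrite modnDr modn_small.
Qed.

(** Along an arc the left rank rises by at most one, so it cannot jump over the forbidden residue.
    At the lowest rank, each return raises the sibling rank by one, so fewer than [K] returns
    precede its forbidden residue. Hence an outer induction on [h] and an inner one on the distance
    [j] of the sibling rank. *)
Lemma tail_path E K i h w p : noncrossing E -> i < K -> path E w p ->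
  {in w :: p, forall q, ~~ left_bad E K i q} ->
  {in p, forall q, left_rank E w <= left_rank E q} ->
  (left_rank E w + h) %% K = i -> size p <= tail_bound K h.
Proof.
move=> ncE iK; elim: h w p => [|h IHh] w p pwp good cp hw.
  have := good w (mem_head _ _); by rewrite /left_bad -hw addn0 eqxx.
suff H j w' p' : path E w' p' -> {in w' :: p', forall q, ~~ left_bad E K i q} ->
    {in p', forall q, left_rank E w' <= left_rank E q} ->
    left_rank E w' = left_rank E w -> (sibling_rank E w' + j) %% K = i ->
    size p' <= j * (tail_bound K h + 2).
  have [j jK jw] := modn_shift (sibling_rank E w) iK.
  apply: leq_trans (H j w p pwp good cp erefl jw) _.
  by rewrite /= leq_mul2r (ltnW jK) orbT.
elim: j w' p' => [|j IHj] {}w' {}p' {pwp good cp}pwp good cp ew jw.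
  have := good w' (mem_head _ _); by rewrite /left_bad -jw addn0 eqxx orbT.
have seg r : path E w' r -> {subset r <= p'} ->
    {in r, forall q, left_rank E w' < left_rank E q} ->
    size r <= (tail_bound K h).+1.
  case: r => //= v r /andP[Ewv pvr] rp cr; rewrite ltnS.
  have ev : left_rank E v = (left_rank E w).+1.
    apply/eqP; rewrite eqn_leq -ew cr ?mem_head // andbT.
    apply: leq_trans (subset_leq_card (left_ends_step ncE Ewv)) _.
    by rewrite cardsU1; case: (_ \notin _).
  apply: IHh pvr _ _ _.
  - by move=> q /rp qp; apply: good; rewrite inE qp orbT.
  - by move=> q qr; rewrite ev -ew; apply: cr; rewrite inE qr orbT.
  - by rewrite ev addSnnS.
(* Cut at the first return to the lowest rank: [seg] bounds the excursion before it, the inner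
   induction bounds the rest. *)
case: (boolP (has (fun q => left_rank E q <= left_rank E w') p')); last first.
  move=> /hasPn nh; have := seg p' pwp (fun q qp => qp).
  have /[swap]/[apply] : {in p', forall q, left_rank E w' < left_rank E q}.
    by move=> q qp; rewrite ltnNge; apply: nh.
  by lia.
move=> hp; case/split_find: hp pwp good cp seg => v p1 p2 lev np1 pwp good cp seg.
have {}lev : left_rank E v = left_rank E w'.
  by apply/eqP; rewrite eqn_leq lev cp // mem_cat mem_rcons mem_head.
have cp1 : {in p1, forall q, left_rank E w' < left_rank E q}.
  by move=> q qp; rewrite ltnNge; apply: (hasPn np1).
move: pwp; rewrite cat_path last_rcons => /andP[pwv pvp2].
have := sibling_rank_next ncE pwv cp1 lev => sv.
have s1 : size p1 <= (tail_bound K h).+1.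
  apply: seg => //; first by move: pwv; rewrite rcons_path => /andP[].
  by move=> q qp; rewrite mem_cat mem_rcons inE qp orbT.
have s2 : size p2 <= j * (tail_bound K h + 2).
  apply: (IHj v) => //.
  - by move=> q qp; apply: good; rewrite inE mem_cat mem_rcons inE -orbA;
      move: qp; rewrite inE => /orP[->|->]; rewrite ?orbT.
  - by move=> q qp; rewrite lev; apply: cp; rewrite mem_cat qp orbT.
  - by rewrite lev.
  - by rewrite sv addSnnS.
by rewrite size_cat size_rcons mulSn; apply: leq_add => //; lia.
Qed.

Lemma tail_boundS K h : 0 < K -> tail_bound K h <= tail_bound K h.+1.
Proof. by move=> K0 /=; nia. Qed.

Lemma tail_bound_mono K h h' : 0 < K -> h <= h' -> tail_bound K h <= tail_bound K h'.
Proof.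
move=> K0 /subnK <-; elim: (h' - h) => // d IH.
by rewrite addSn; apply: leq_trans IH (tail_boundS _ K0).
Qed.

Lemma tail_path_le E K i w p : noncrossing E -> i < K -> path E w p ->
  {in w :: p, forall q, ~~ left_bad E K i q} ->
  {in p, forall q, left_rank E w <= left_rank E q} -> size p <= tail_bound K K.
Proof.
move=> ncE iK pwp good cp; have [h hK hw] := modn_shift (left_rank E w) iK.
apply: leq_trans (tail_path ncE iK pwp good cp hw) _.
by apply: tail_bound_mono (ltnW hK); apply: leq_ltn_trans iK.
Qed.

(** * Right ends, by reflection *)

Definition mirror E : rel 'I_N := fun u v => E (rev_ord v) (rev_ord u).

Lemma ltn_rev_ord u v : (rev_ord u < rev_ord v) = (v < u).
Proof. by rewrite /=; have := ltn_ord u; have := ltn_ord v; lia. Qed.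

Lemma noncrossing_mirror E : noncrossing E -> noncrossing (mirror E).
Proof.
move=> [Elt nc]; split=> [u v /Elt|a b u v Eab Euv au ub].
  by rewrite ltn_rev_ord.
have := nc _ _ _ _ Euv Eab; rewrite !ltn_rev_ord => H.
rewrite leqNgt; apply/negP => bv; have := H bv ub.
by rewrite leqNgt ltn_rev_ord au.
Qed.

Definition right_rank E v := left_rank (mirror E) (rev_ord v).

Lemma right_endsP E v b :
  reflect (exists a, [/\ a < v, v < b & E a b])
    (rev_ord b \in left_ends (mirror E) (rev_ord v)).
Proof.
apply: (iffP (left_endsP _ _ _)) => [[a []]|[a [av vb Eab]]].
  rewrite ltn_rev_ord => vb va Ea; exists (rev_ord a).
  by move: va Ea; rewrite /mirror rev_ordK -{1}(rev_ordK a) ltn_rev_ord.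
by exists (rev_ord a); rewrite /mirror !rev_ordK !ltn_rev_ord.
Qed.

(** Suppose the left rank first fails to exceed that of [w] at [v]. Then [w] is no left end over
    [v]. An arc over [v] must then start before [w]: if it started later, it would be nested in an
    arc from [w] over the previous point, and that arc would cover [v]. So the arc covers [w] too,
    every right end over [v] is one over [w], and the right rank has not increased either. *)
Lemma right_rank_cross E w p : noncrossing E -> path E w p ->
  {in p, forall q, right_rank E w < right_rank E q} ->
  {in p, forall q, left_rank E w < left_rank E q}.
Proof.
move=> ncE; elim/last_ind: p => // p v IHp.
rewrite rcons_path => /andP[pwp Euv] cp.
have {IHp}kp : {in p, forall q, left_rank E w < left_rank E q}.
  by apply: IHp => // q qp; apply: cp; rewrite mem_rcons inE qp orbT.
move=> q; rewrite mem_rcons inE => /orP[/eqP->{q}|/kp//].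
have := cp v; rewrite mem_rcons mem_head => /(_ isT); apply: contraLR.
rewrite -leqNgt => kv; rewrite -leqNgt.
have wnv : w \notin left_ends E v.
  apply: contraL kv => wv; rewrite -ltnNge.
  have -> : (left_rank E w).+1 = #|w |: left_ends E w|.
    by rewrite cardsU1 inE ltnn.
  by apply: subset_leq_card; rewrite subUset sub1set wv left_ends_trans.
apply: subset_leq_card; apply/subsetP => b'; rewrite -(rev_ordK b').
move: (rev_ord b') => b /right_endsP[a [av vb Eab]]; apply/right_endsP.
have wu : w <= last w p by apply: path_last_ge pwp.
exists a; split=> //; last first.
  by apply: leq_ltn_trans wu (ltn_trans (ncE.1 _ _ Euv) vb).
rewrite ltnNge; apply/negP => wa; apply: (negP wnv).
have au : a <= last w p.
  rewrite leqNgt; apply/negP => ua.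
  by have := ncE.2 _ _ _ _ Euv Eab ua av; rewrite leqNgt vb.
case: (ltngtP w a) wa => // [wa _|/val_inj-> _]; last by apply/left_endsP; exists b.
have : w \in left_ends E (last w p).
  apply: (path_strict_left_ends ncE pwp kp).
  have /predU1P[e|//] := mem_last w p.
  by rewrite e leqNgt wa in au.
move=> /left_endsP[c [wlu uc Ewc]]; apply/left_endsP; exists c; split=> //.
  exact: leq_ltn_trans wu (ncE.1 _ _ Euv).
rewrite ltnNge; apply/negP => cv.
have := ncE.2 _ _ _ _ Ewc Eab wa (leq_ltn_trans au uc).
by rewrite leqNgt (leq_ltn_trans cv vb).
Qed.

Definition cut_at E K i v :=
  left_bad E K i v || left_bad (mirror E) K i (rev_ord v).

Lemma path_rev (T : Type) (e : rel T) x p y q : path e x p ->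
  rcons q y = x :: p -> path (fun s t => e t s) y (rev q).
Proof.
move=> pp eq; have : path (fun s t => e t s) (last x p) (rev (belast x p)).
  by rewrite rev_path; exact: pp.
have -> : last x p = y.
  by have := congr1 (last x) eq; rewrite last_rcons.
have -> // : belast x p = q.
by have := lastI x p; rewrite -eq => /rcons_inj[].
Qed.

(* After the last point of minimal right rank the left rank stays above its
   value there, so this point splits the path into two tails, one of [E] and
   one of its mirror image. *)
Lemma good_path_size E K i x p : noncrossing E -> i < K -> path E x p ->
  {in x :: p, forall q, ~~ cut_at E K i q} -> size p <= (tail_bound K K).*2.
Proof.
move=> ncE iK pxp good.
have [w [p3 [p4 [ep min3 min4]]]] : exists w p3 p4, [/\ x :: p = rcons p3 w ++ p4,
    {in p3, forall q, right_rank E w <= right_rank E q} &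
    {in p4, forall q, right_rank E w < right_rank E q}].
  elim: p x {pxp good} => [|y p IHp] x; first by exists x, [::], [::].
  have [w [p3 [p4 [-> m3 m4]]]] := IHp y.
  case: (leqP (right_rank E w) (right_rank E x)) => [wx|xw].
    exists w, (x :: p3), p4; split=> // q; rewrite inE => /orP[/eqP->//|].
    exact: m3.
  exists x, [::], (rcons p3 w ++ p4); split=> // q.
  rewrite mem_cat mem_rcons inE -orbA => /or3P[/eqP->//|/m3|/m4].
    exact: leq_trans.
  exact: ltn_trans.
have szp : size p = size p3 + size p4.
  by have := congr1 size ep; rewrite /= size_cat size_rcons addSn => -[].
have [pa [ea pw3 pw4]] : exists pa, [/\ rcons p3 w = x :: pa, path E x pa
    & path E w p4].
  case: p3 ep {min3 szp} => [|y p3] /= [<- ep]; last first.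
    exists (rcons p3 w); move: pxp; rewrite ep cat_path last_rcons.
    by case/andP=> -> ->.
  by exists [::]; move: pxp; rewrite ep /=.
rewrite szp -addnn; apply: leq_add; last first.
  apply: (tail_path_le ncE iK pw4); last first.
    by move=> q qp; apply/ltnW/(right_rank_cross ncE pw4 min4).
  move=> q qp; have /good : q \in x :: p.
    by rewrite ep mem_cat mem_rcons inE; move: qp; rewrite inE => /orP[->|->]; rewrite ?orbT.
  by rewrite negb_or => /andP[].
have := path_rev pw3 ea; rewrite -(size_rev p3) -(size_map (@rev_ord N)) => pr.
apply: (tail_path_le (noncrossing_mirror ncE) iK (w := rev_ord w)).
- rewrite path_map; apply: sub_path pr => u v /=.
  by rewrite /mirror /= !rev_ordK.
- move=> q; rewrite -map_cons => /mapP[r rp ->]; have /good : r \in x :: p.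
    by rewrite ep mem_cat mem_rcons inE; move: rp; rewrite inE mem_rev => /orP[->|->]; rewrite ?orbT.
  by rewrite negb_or => /andP[].
- by move=> q /mapP[r]; rewrite mem_rev => /min3 ? ->.
Qed.

(** Each of the four ranks of a point excludes one residue, so the sum over all [i] counts every [u]
    at most four times. The count runs over [U] because several nodes may share a position. *)
Lemma exists_small_cut E K (U : finType) (l : U -> 'I_N) : 0 < K ->
  exists2 i, i < K & K * #|[set u | cut_at E K i (l u)]| <= 4 * #|U|.
Proof.
move=> K0.
have [i Hi] := @exists_le_average K (fun i : 'I_K => #|[set u | cut_at E K i (l u)]|) K0.
exists i => //; apply: leq_trans Hi _.
under eq_bigr => j _.
  rewrite cardE -sum1_size big_enum_cond /= big_mkcond /=; over.
rewrite exchange_big /= mulnC -sum_nat_const; apply: leq_sum => u _.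
have one m : \sum_(j < K) (m %% K == j) = 1.
  rewrite (bigD1 (Ordinal (ltn_pmod m K0))) //= eqxx big1 ?addn0 // => j.
  by rewrite -val_eqE /= eq_sym => /negbTE->.
have -> : 4 = \sum_(j < K) (left_rank E (l u) %% K == j) +
    \sum_(j < K) (sibling_rank E (l u) %% K == j) +
    \sum_(j < K) (left_rank (mirror E) (rev_ord (l u)) %% K == j) +
    \sum_(j < K) (sibling_rank (mirror E) (rev_ord (l u)) %% K == j).
  by rewrite !one.
rewrite -!big_split /=.
apply: leq_sum => j _; rewrite inE /cut_at /left_bad.
by do 4!case: (_ == _).
Qed.

End NonCrossing.

(** * Boolean functions as polynomials over the field with two elements *)

(** Agreement is asked on [T] only, since a circuit simplified after some guesses is correct only
    where they hold. *)
Definition represents (n d : nat) (T : {set cube n}) (h : cube n -> bool) :=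
  exists2 p : mpoly.mpoly n 'F_2, mpoly.msize p <= d.+1 &
    {in T, forall x, peval p x = (h x : nat)%:R%R}.

Lemma represents_mono n d d' (T : {set cube n}) h :
  d <= d' -> represents d T h -> represents d' T h.
Proof. by move=> dd' [p sp ev]; exists p => //; apply: leq_trans sp _. Qed.

Lemma represents_var n (T : {set cube n}) (i : 'I_n) :
  represents 1 T (fun x => x i).
Proof.
exists (mpoly.mpolyX 'F_2 (mpoly.mnm1 i)); first by rewrite mpoly.msizeX mpoly.mdeg1.
by move=> x _; rewrite /peval mpoly.mevalXU.
Qed.

Lemma represents_const n (T : {set cube n}) (c : bool) :
  represents 0 T (fun=> c).
Proof.
exists (mpoly.mpolyC n (c : nat)%:R%R).
  by rewrite mpoly.msizeC; case: (_ != _).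
by move=> x _; rewrite /peval mpoly.mevalC.
Qed.

Lemma msizeD_bound n (p q : mpoly.mpoly n 'F_2) d :
  mpoly.msize p <= d -> mpoly.msize q <= d -> mpoly.msize (p + q)%R <= d.
Proof.
move=> sp sq; apply: leq_trans (mpoly.msizeD_le _ _) _.
by rewrite geq_max sp.
Qed.

Lemma msizeM_bound n (p q : mpoly.mpoly n 'F_2) d e :
  mpoly.msize p <= d.+1 -> mpoly.msize q <= e.+1 ->
  mpoly.msize (p * q)%R <= (d + e).+1.
Proof.
move=> sp sq; have [->|p0] := eqVneq p 0%R; first by rewrite mul0r mpoly.msize0.
have [->|q0] := eqVneq q 0%R; first by rewrite mulr0 mpoly.msize0.
rewrite mpoly.msizeM //; move: (mpoly.msize p) (mpoly.msize q) sp sq => a b.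
by lia.
Qed.

Lemma represents_op n d e (T : {set cube n}) h h' (op : bool -> bool -> bool) :
  represents d T h -> represents e T h' ->
  represents (d + e) T (fun x => op (h x) (h' x)).
Proof.
move=> [p sp ep] [q sq eq].
pose c a b := mpoly.mpolyC n ((op a b : nat)%:R%R : 'F_2).
pose C1 := mpoly.mpolyC n (1%R : 'F_2).
have sc a b : mpoly.msize (c a b) <= 1 by rewrite mpoly.msizeC; case: (_ != _).
have s1 : mpoly.msize C1 <= 1 by rewrite mpoly.msizeC; case: (_ != _).
have sN (r : mpoly.mpoly n 'F_2) k : mpoly.msize r <= k.+1 -> mpoly.msize (C1 - r)%R <= k.+1.
  move=> sr; apply: msizeD_bound; first exact: leq_trans s1 _.
  by rewrite mpoly.msizeN.
(* Interpolation through the four rows of the truth table of [op]: at each point exactly one of the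
   four products is 1. *)
exists (c false false * ((C1 - p) * (C1 - q)) + c false true * ((C1 - p) * q)
  + c true false * (p * (C1 - q)) + c true true * (p * q))%R.
  have sM (r1 r2 r3 : mpoly.mpoly n 'F_2) : mpoly.msize r1 <= 1 -> mpoly.msize r2 <= d.+1 ->
      mpoly.msize r3 <= e.+1 -> mpoly.msize (r1 * (r2 * r3))%R <= (d + e).+1.
    move=> h1 h2 h3; exact: (msizeM_bound h1 (msizeM_bound h2 h3)).
  apply: msizeD_bound; last by apply: sM.
  apply: msizeD_bound; last by apply: sM => //; apply: sN.
  apply: msizeD_bound; last by apply: sM => //; apply: sN.
  by apply: sM => //; apply: sN.
move=> x xT; have := ep x xT; have := eq x xT.
rewrite /peval !(mpoly.mevalD, mpoly.mevalM, mpoly.mevalN) !mpoly.mevalC => -> ->.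
by case: (h x); case: (h' x);
  rewrite ?mulr1n ?mulr0n ?subrr ?subr0 ?(mulr0, mul0r) ?(mulr1, mul1r) ?(addr0, add0r).
Qed.

Lemma represents_unary n d (T : {set cube n}) h (phi : bool -> bool) :
  represents d T h -> represents d T (fun x => phi (h x)).
Proof.
move=> rh; rewrite -[d]addn0.
exact: (represents_op (fun a _ => phi a) rh (represents_const T true)).
Qed.

(** Varieties are sets of zeros, so the polynomial is that of the negation. *)
Lemma represents_zero n d (T : {set cube n}) h : represents d T h ->
  exists2 p : mpoly.mpoly n 'F_2, mpoly.msize p <= d.+1 &
    {in T, forall x, (peval p x == 0%R) = h x}.
Proof.
move=> /(represents_unary negb) [p sp ep]; exists p => // x /ep ->.
by case: (h x).
Qed.

Definition zeros n (ps : seq (mpoly.mpoly n 'F_2)) : {set cube n} :=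
  [set x : cube n | all (fun p => peval p x == 0%R) ps].

Lemma disperser_zeros (R : realType) n (f : boolfun n) (d : R) m (s : R) ps :
  disperser d m s f -> ((size ps)%:R%:E <= m)%E ->
  (forall p, p \in ps -> degree_le p d) -> {in zeros ps, forall x, f x} ->
  (#|zeros ps|%:R <= s)%R.
Proof.
move=> df sm dp f1; rewrite leNgt; apply/negP => lt.
have [|x [y [xS yS]]] := df (zeros ps) _ lt; first by exists ps.
by rewrite !f1.
Qed.

Lemma majority_card n (f : boolfun n) : majority_one f ->
  2 ^ n <= 2 * #|[set x | f x]|.
Proof.
move=> mf; have := cardsC [set x : cube n | f x].
have -> : ~: [set x : cube n | f x] = [set x : cube n | ~~ f x].
  by apply/setP => x; rewrite !inE.
rewrite card_ffun card_bool card_ord => <-.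
by rewrite mul2n -addnn leq_add2l.
Qed.

(** * Guessing the values of some nodes *)

(** Pigeonhole, one node at a time: the more frequent value keeps at least half of the points. The
    point [x0] records all the chosen values at once. *)
Lemma exists_popular_class (X U : finType) (V : U -> X -> bool) (us : seq U)
    (T : {set X}) : T != set0 -> exists2 x0, x0 \in T &
  #|T| <= 2 ^ size us * #|[set x in T | all (fun u => V u x == V u x0) us]|.
Proof.
elim: us T => [|u us IHus] T T0.
  have /set0Pn[x0 x0T] := T0; exists x0; rewrite // mul1n.
  by apply: subset_leq_card; apply/subsetP => x; rewrite inE => ->.
have [c Tc] : exists c, #|T| <= 2 * #|[set x in T | V u x == c]|.
  have e : #|T| = #|[set x in T | V u x == true]| + #|[set x in T | V u x == false]|.
    rewrite -(cardsID [set x | V u x == true]); congr (_ + _);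
      apply: eq_card => x; rewrite !inE //.
    by rewrite andbC; case: (V u x).
  case: (leqP #|[set x in T | V u x == true]| #|[set x in T | V u x == false]|) => le.
    by exists false; rewrite {}e mul2n -addnn leq_add2r.
  by exists true; rewrite {}e mul2n -addnn leq_add2l ltnW.
have [|x0] := IHus [set x in T | V u x == c].
  rewrite -card_gt0; move: T0; rewrite -card_gt0 => T0.
  by have := leq_trans T0 Tc; rewrite muln_gt0.
rewrite inE => /andP[x0T /eqP Vc] H; exists x0 => //.
apply: leq_trans Tc _; rewrite expnS -mulnA leq_mul2l /=.
apply: leq_trans H _; rewrite leq_mul2l; apply/orP; right.
by apply: subset_leq_card; apply/subsetP => x; rewrite !inE /= Vc -andbA.
Qed.

Section Values.

Variables (n : nat) (C : circuit n) (f : boolfun n).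

Definition value_map (V : node C -> cube n -> bool) :=
  [/\ forall i x, V (inl i) x = x i,
      forall g x, V (inr g) x = gate_op g (V (gate_in1 g) x) (V (gate_in2 g) x)
    & forall x, V (output C) x = f x].

Lemma computes_value_map : computes C f -> exists V, value_map V.
Proof.
move=> Cf; have /choice[W HW] : forall x, exists val : node C -> bool,
    valuation x val /\ val (output C) = f x.
  by move=> x; have [val] := Cf x; exists val.
exists (fun v x => W x v); split=> [i x|g x|x].
- exact: (HW x).1.1.
- exact: (HW x).1.2.
- exact: (HW x).2.
Qed.

(** A topological numbering, strictly increasing along wires by acyclicity. *)
Definition wire_rank (v : node C) := #|[set u | connect (@wire n C) u v]|.

Lemma wire_rank_lt u v : wire u v -> wire_rank u < wire_rank v.
Proof.
move=> uv; apply: proper_card; apply/properP; split.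
  apply/subsetP => w; rewrite !inE => /connect_trans; apply.
  exact: connect1.
exists v; rewrite inE; first exact: connect0.
exact: (circuit_acyclic uv).
Qed.

Lemma wire_in1 (g : 'I_(csize C)) : wire (gate_in1 g) (inr g : node C).
Proof. by rewrite /wire /= eqxx. Qed.

Lemma wire_in2 (g : 'I_(csize C)) : wire (gate_in2 g) (inr g : node C).
Proof. by rewrite /wire /= eqxx orbT. Qed.

Variables (B : {set node C}) (b : node C -> bool).

(** Wires leaving [B] carry the guessed values [b], but a gate of [B] is still computed from its own
    inputs, so that the guess can be tested. [k] is fuel: the default [false] is never reached as
    long as [k] exceeds the label of the node. *)
Fixpoint cut_value (k : nat) (v : node C) (x : cube n) : bool :=
  match v with
  | inl i => x i
  | inr g => if k is k'.+1 then
      let get u := if u \in B then b u else cut_value k' u x in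
      gate_op g (get (gate_in1 g)) (get (gate_in2 g))
    else false
  end.

Lemma represents_cut_value k v : represents (2 ^ k) [set: cube n] (cut_value k v).
Proof.
elim: k v => [|k IHk] [i|g].
- exact: represents_var.
- by apply: (@represents_mono _ 0) => //; apply: represents_const.
- by apply: (@represents_mono _ 1); [rewrite expn_gt0|apply: represents_var].
- rewrite expnS mul2n -addnn.
  have get u : represents (2 ^ k) [set: cube n]
      (fun x => if u \in B then b u else cut_value k u x).
    case: (u \in B); last exact: IHk.
    by apply: (@represents_mono _ 0) => //; apply: represents_const.
  exact: (represents_op (@gate_op _ C g) (get _) (get _)).
Qed.

Variable psi : node C -> nat.
Hypothesis psi_lt : forall u v, wire u v -> u \notin B -> psi u < psi v.

Lemma cut_value_stable k k' v x : psi v < k -> psi v < k' ->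
  cut_value k v x = cut_value k' v x.
Proof.
elim: k k' v => // k IHk [|k'] [i|g] //= lk lk'.
have get u : wire u (inr g : node C) ->
    (if u \in B then b u else cut_value k u x) =
    (if u \in B then b u else cut_value k' u x).
  move=> w; case: ifPn => // uB; have lt := psi_lt w uB.
  by apply: IHk; [apply: leq_trans lt lk|apply: leq_trans lt lk'].
by rewrite !get ?wire_in1 ?wire_in2.
Qed.

Variables (V : node C -> cube n -> bool) (VP : value_map V).

Lemma cut_value_correct k v x : {in B, forall u, V u x = b u} -> psi v < k ->
  cut_value k v x = V v x.
Proof.
have [V1 V2 _] := VP.
move=> VB; elim: k v => // k IHk [i|g] /= lk; first by rewrite V1.
have get u : wire u (inr g : node C) ->
    (if u \in B then b u else cut_value k u x) = V u x.
  move=> w; case: ifPn => [/VB->//|uB]; apply: IHk.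
  exact: leq_trans (psi_lt w uB) lk.
by rewrite !get ?wire_in1 ?wire_in2 // V2.
Qed.

(** A self-consistent guess is the true one. The induction follows [wire_rank], because [psi] need
    not increase along wires that leave [B]; at each gate the guessed inputs equal the computed
    ones, which are already known to be true. *)
Lemma cut_value_consistent k x : (forall v, psi v < k) ->
  {in B, forall u, cut_value k u x = b u} -> forall v, cut_value k v x = V v x.
Proof.
have [V1 V2 _] := VP.
move=> psik FB v; have [m] := ubnP (wire_rank v).
elim: m v => // m IHm [i|g] lm; first by rewrite V1; case: (k).
case: k psik FB IHm => [/(_ (inr g))//|k] psik FB IHm /=.
have get u : wire u (inr g : node C) ->
    (if u \in B then b u else cut_value k u x) = V u x.
  move=> w; have lt : wire_rank u < m := leq_trans (wire_rank_lt w) lm.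
  rewrite -(IHm _ lt); case: ifPn => [/FB->//|uB].
  have ltk : psi u < k := leq_trans (psi_lt w uB) (psik (inr g)).
  by apply: cut_value_stable => //; apply: ltn_trans ltk _.
by rewrite !get ?wire_in1 ?wire_in2 // V2.
Qed.

End Values.

(** One equation says that the output computed from the guess is 1, the others that the guess is
    self-consistent, which makes this output correct. The points of the most popular class satisfy
    all of them. *)
Lemma guess_zeros n (C : circuit n) (f : boolfun n) (B : {set node C})
    (psi : node C -> nat) (k : nat) :
  computes C f -> (forall u v, wire u v -> u \notin B -> psi u < psi v) ->
  (forall v, psi v < k) ->
  exists ps : seq (mpoly.mpoly n 'F_2),
    [/\ size ps = #|B|.+1, {in ps, forall p, mpoly.msize p <= (2 ^ k).+1},
        {in zeros ps, forall x, f x} &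
        #|[set x | f x]| <= 2 ^ #|B| * #|zeros ps|].
Proof.
move=> /computes_value_map[V VP] psi_lt psik.
(* If [f] has no ones, copies of the constant polynomial 1 give the empty variety. *)
have [f0|T0] := eqVneq [set x | f x] set0.
  have [p sp ep] := represents_zero (represents_const [set: cube n] false).
  exists (nseq #|B|.+1 p); split; rewrite ?size_nseq //.
  - by move=> q /nseqP[-> _]; apply: leq_trans sp _.
  - by move=> x; rewrite inE /= ep.
  - by rewrite f0 cards0.
have [x0 x0T cT] := exists_popular_class V (enum B) T0.
pose b u := V u x0; pose F := cut_value B b k.
have /choice[P HP] : forall u, exists p : mpoly.mpoly n 'F_2,
    mpoly.msize p <= (2 ^ k).+1 /\ forall x, (peval p x == 0%R) = (F u x == b u).
  move=> u; have [p sp ep] := represents_zero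
    (represents_unary (fun a => a == b u) (represents_cut_value B b k u)).
  by exists p; split=> // x; rewrite ep ?inE.
have [po spo epo] := represents_zero (represents_cut_value B b k (output C)).
exists (po :: map P (enum B)); split.
- by rewrite /= size_map -cardE.
- move=> p; rewrite inE => /orP[/eqP->//|/mapP[u _ ->]].
  by have [] := HP u.
- move=> x; rewrite inE /= epo ?inE // all_map => /andP[Fo /allP FB].
  have [_ _ <-] := VP; rewrite -(@cut_value_consistent _ C f B b psi psi_lt V VP k) //.
  move=> u uB; have := FB u; rewrite mem_enum => /(_ uB) /=.
  by rewrite (HP u).2 => /eqP.
- apply: leq_trans cT _; rewrite -cardE leq_mul2l; apply/orP; right.
  apply: subset_leq_card; apply/subsetP => x; rewrite !inE => /andP[fx /allP Vx].
  have VB : {in B, forall u, V u x = b u}.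
    by move=> u uB; apply/eqP; apply: Vx; rewrite mem_enum.
  have FV v := cut_value_correct psi_lt VP VB (psik v).
  rewrite /= epo ?inE // FV; have [_ _ ->] := VP; rewrite fx /=.
  rewrite all_map; apply/allP => u; rewrite mem_enum => uB /=.
  by rewrite (HP u).2 /F FV VB.
Qed.

(** * Depth reduction *)

(** The label is the length of a longest path ending at the node. *)
Lemma exists_path_label (T : eqType) (e : rel T) (L : nat) :
  (forall x p, path e x p -> size p <= L) ->
  exists2 psi : T -> nat, (forall u v, e u v -> psi u < psi v) &
    forall v, psi v <= L.
Proof.
move=> bnd.
pose ends r v := exists x p, [/\ path e x p, last x p = v & size p = r].
pose psi v := \max_(r < L.+1 | `[< ends r v >]) (r : nat).
exists psi; last by move=> v; apply/bigmax_leqP => r _; rewrite -ltnS.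
move=> u v uv.
have [r] : exists r : 'I_L.+1, psi u = r /\ `[< ends r u >].
  have : 0 < #|[pred r : 'I_L.+1 | `[< ends r u >]]|.
    apply/card_gt0P; exists ord0; rewrite inE; apply/asboolP.
    by exists u, [::].
  by case/(eq_bigmax_cond (fun r : 'I_L.+1 => (r : nat)))=> r rP e0; exists r.
move=> [-> /asboolP[x [p [pp lp sp]]]].
have pv : path e x (rcons p v) by rewrite rcons_path pp lp.
have rL : r.+1 < L.+1.
  by rewrite ltnS; have := bnd _ _ pv; rewrite size_rcons sp.
apply: (@leq_bigmax_cond _ _ (fun r : 'I_L.+1 => (r : nat)) (Ordinal rL)).
by apply/asboolP; exists x, (rcons p v); rewrite last_rcons size_rcons sp.
Qed.

(** The depth bounds only paths from inputs; prolonging a path backwards to an input extends the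
    bound to all paths. *)
Lemma exists_input_path n (C : circuit n) (v : node C) :
  exists i p, path (@wire n C) (inl i) p /\ last (inl i) p = v.
Proof.
have [m] := ubnP (wire_rank v); elim: m v => // m IHm [i|g] lm.
  by exists i, [::].
have w := wire_in1 g.
have [i [p [pp lp]]] := IHm _ (leq_trans (wire_rank_lt w) lm).
by exists i, (rcons p (inr g)); rewrite rcons_path pp lp last_rcons.
Qed.

Lemma depth_label (R : realType) n (C : circuit n) (D : R) L :
  depth_le C D -> (D < L.+1%:R)%R ->
  exists2 l : node C -> nat, (forall u v, wire u v -> l u < l v) &
    forall v, l v <= L.
Proof.
move=> dC DL; apply: exists_path_label => v p pv.
have [i [q [pq lq]]] := exists_input_path v.
have := dC i (q ++ p); rewrite cat_path pq lq => /(_ pv) le.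
rewrite -ltnS -(ltr_nat R); apply: le_lt_trans DL.
by apply: le_trans le; rewrite ler_nat size_cat leq_addl.
Qed.

(* Removing the [r] binary digits starting at position [i * r] from the labels
   destroys only the wires whose labels first differ in that block of digits. *)
Lemma valiant_cut n (C : circuit n) (l : node C -> nat) k q r : 0 < q ->
  q * r <= k -> (forall u v, wire u v -> l u < l v) -> (forall v, l v < 2 ^ k) ->
  exists (B : {set node C}) (psi : node C -> nat),
    [/\ forall u v, wire u v -> u \notin B -> psi u < psi v,
        forall v, psi v < 2 ^ (k - r) & q * #|B| <= 2 * csize C].
Proof.
move=> q0 qrk l_lt lk.
pose lo i := 2 ^ (i * r); pose hi i := 2 ^ (i.+1 * r).
(* The digits above block [i] agree and those of the block differ; a wire is bad for at most one
   block. *)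
pose bad i (u v : node C) := (l u %/ hi i == l v %/ hi i) && (l u %/ lo i < l v %/ lo i).
pose S1 i := [set g : 'I_(csize C) | bad i (gate_in1 g) (inr g)].
pose S2 i := [set g : 'I_(csize C) | bad i (gate_in2 g) (inr g)].
have le_hl i j : i < j -> hi i %| lo j.
  by move=> ij; apply: dvdn_exp2l; rewrite leq_mul2r ij orbT.
have once (u v : node C) : \sum_(i < q) bad i u v <= 1.
  have [/forallP nb|] := boolP [forall i : 'I_q, ~~ bad i u v].
    by rewrite big1 // => i _; rewrite (negbTE (nb i)).
  rewrite negb_forall => /existsP[i]; rewrite negbK => bi.
  rewrite (bigD1 i) //= bi big1 // => j nij; case bj: (bad j u v) => //.
  exfalso; wlog ij : i j bi bj nij / i < j.
    move=> H; case: (ltngtP i j) => [||/val_inj e]; first exact: H bi bj nij.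
      by apply: H bj bi _; rewrite eq_sym.
    by rewrite e eqxx in nij.
  have /dvdnP[c ec] := le_hl _ _ ij.
  have /andP[/eqP e _] := bi; have /andP[_] := bj.
  by rewrite ec mulnC !divnMA e ltnn.
have [i Hi] := @exists_le_average q (fun i : 'I_q => #|S1 i| + #|S2 i|) q0.
have sumS (h : 'I_(csize C) -> node C) :
    \sum_(i < q) #|[set g | bad i (h g) (inr g)]| <= csize C.
  under eq_bigr => j _.
    rewrite cardE -sum1_size big_enum_cond /= big_mkcond /=; over.
  rewrite exchange_big /= -[leqRHS]card_ord -sum1_card.
  apply: leq_sum => g _; apply: leq_trans (once (h g) (inr g)).
  by apply: leq_sum => j _; rewrite inE; case: (bad _ _ _).
(* The tails of the bad wires are cut, and the new label deletes block [i] and closes the gap. Each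
   gate has two incoming wires, whence the factor 2. *)
exists ((@gate_in1 n C) @: S1 i :|: (@gate_in2 n C) @: S2 i).
exists (fun v => l v %/ hi i * lo i + l v %% lo i).
have lo0 j : 0 < lo j by rewrite expn_gt0.
have hi0 j : 0 < hi j by rewrite expn_gt0.
split.
- move=> u v uv uB; have luv := l_lt _ _ uv.
  have nbad : ~~ bad i u v.
    case: v uv {luv} => // g; rewrite /wire /= => /orP[]/eqP e; apply: contra uB;
      rewrite e => bi; rewrite inE; apply/orP; [left|right];
      by apply/imsetP; exists g; rewrite ?inE.
  have := leq_div2r (hi i) (ltnW luv); rewrite leq_eqVlt => /orP[e|lt].
    move: nbad; rewrite /bad e /= -leqNgt => le2.
    have e2 : l u %/ lo i = l v %/ lo i.
      by apply/eqP; rewrite eqn_leq le2 leq_div2r // ltnW.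
    rewrite (eqP e) ltn_add2l.
    by move: luv; rewrite (divn_eq (l u) (lo i)) (divn_eq (l v) (lo i)) e2 ltn_add2l !modnMDl !modn_mod.
  have m1 : l u %% lo i < lo i by rewrite ltn_mod.
  by nia.
- move=> v.
  have ik : i.+1 * r <= k by apply: leq_trans qrk; rewrite leq_mul2r ltn_ord orbT.
  have lt : l v %/ hi i < 2 ^ (k - i.+1 * r).
    by rewrite ltn_divLR // -expnD subnK.
  have -> : 2 ^ (k - r) = 2 ^ (k - i.+1 * r) * lo i.
    by rewrite -expnD; congr (_ ^ _); rewrite mulSn in ik *; lia.
  have m1 : l v %% lo i < lo i by rewrite ltn_mod.
  by nia.
- apply: leq_trans (leq_trans Hi _).
    rewrite leq_mul2l; apply/orP; right.
    rewrite cardsU; apply: leq_trans (leq_subr _ _) _.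
    by apply: leq_add; apply: leq_imset_card.
  by rewrite big_split /= mul2n -addnn; apply: leq_add; apply: sumS.
Qed.

Lemma series_parallel_cut n (C : circuit n) K : 0 < K -> series_parallel C ->
  exists (B : {set node C}) (psi : node C -> nat),
    [/\ forall u v, wire u v -> u \notin B -> psi u < psi v,
        forall v, psi v <= (tail_bound K K).*2.+1 & K * #|B| <= 4 * (n + csize C)].
Proof.
move=> K0 [l0 [l0_lt nc0]].
pose N := (\max_v l0 v).+1.
have l0N v : l0 v < N by rewrite ltnS; apply: leq_bigmax.
pose l v := Ordinal (l0N v).
pose E : rel 'I_N := fun a b => [exists u, exists v, [&& wire u v, l u == a & l v == b]].
have EP a b : reflect (exists u v, [/\ wire u v, l u = a & l v = b]) (E a b).
  apply: (iffP existsP) => [[u /existsP[v /and3P[w /eqP eu /eqP ev]]]|[u [v [w eu ev]]]].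
    by exists u, v.
  by exists u; apply/existsP; exists v; rewrite w eu ev !eqxx.
have ncE : noncrossing E.
  split=> [a b /EP[u [v [w <- <-]]]|a b c d]; first exact: l0_lt.
  move=> /EP[u [v [w <- <-]]] /EP[u' [v' [w' <- <-]]] /= h1 h2.
  rewrite leqNgt; apply/negP => h3; apply: nc0.
  by exists u, v, u', v'.
have [i iK ci] := exists_small_cut E l K0.
exists [set u | cut_at E K i (l u)].
have [|psi psi_lt psiL] := @exists_path_label _
    (fun u v : node C => wire u v && (u \notin [set u | cut_at E K i (l u)]))
    (tail_bound K K).*2.+1.
  (* All nodes of the path but the last are uncut, which accounts for the extra arc in the bound. *)
  move=> x p; case/lastP: p => // p v pp; rewrite size_rcons ltnS.
  have [pE good] : path E (l x) (map l p) /\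
      {in l x :: map l p, forall q, ~~ cut_at E K i q}.
    elim: p x pp => [|y p IHp] x /= /andP[/andP[w]]; rewrite inE => gx pp.
      by split=> // q; rewrite inE => /eqP->.
    have [-> gp] := IHp _ pp; rewrite andbT; split.
      by apply/EP; exists x, y.
    by move=> q; rewrite inE => /orP[/eqP->//|]; apply: gp.
  by have := good_path_size ncE iK pE good; rewrite size_map.
exists psi; split=> //.
  by move=> u v w uB; apply: psi_lt; rewrite w.
by apply: leq_trans ci _; rewrite card_sum !card_ord.
Qed.

(** * Gate elimination *)

(** Degenerate gates (constants included) give the first two cases, parity-type gates the third. The
    others are of conjunction type: one value [c] determines both inputs. *)
Lemma binary_op_cases (op : bool -> bool -> bool) :
  [\/ exists phi, forall p q, op p q = phi p,
      exists phi, forall p q, op p q = phi q,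
      exists c, forall p q, op p q = p (+) q (+) c
    | exists c, exists p0, exists q0, forall p q, op p q = c -> p = p0 /\ q = q0].
Proof.
case e1: (op true true); case e2: (op true false);
case e3: (op false true); case e4: (op false false);
by first
  [ by apply: Or41; exists (fun p => op p true); do 2!case; rewrite ?e1 ?e2 ?e3 ?e4
  | by apply: Or42; exists (fun q => op true q); do 2!case; rewrite ?e1 ?e2 ?e3 ?e4
  | by apply: Or43; exists (op false false); do 2!case; rewrite ?e1 ?e2 ?e3 ?e4
  | by apply: Or44; exists true, true, true; do 2!case; rewrite ?e1 ?e2 ?e3 ?e4
  | by apply: Or44; exists true, true, false; do 2!case; rewrite ?e1 ?e2 ?e3 ?e4
  | by apply: Or44; exists true, false, true; do 2!case; rewrite ?e1 ?e2 ?e3 ?e4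
  | by apply: Or44; exists true, false, false; do 2!case; rewrite ?e1 ?e2 ?e3 ?e4
  | by apply: Or44; exists false, true, true; do 2!case; rewrite ?e1 ?e2 ?e3 ?e4
  | by apply: Or44; exists false, true, false; do 2!case; rewrite ?e1 ?e2 ?e3 ?e4
  | by apply: Or44; exists false, false, true; do 2!case; rewrite ?e1 ?e2 ?e3 ?e4
  | by apply: Or44; exists false, false, false; do 2!case; rewrite ?e1 ?e2 ?e3 ?e4 ].
Qed.

Section Elimination.

Variables (n : nat) (G : finType) (rk : G -> nat).
Hypothesis rk_inj : injective rk.
Variables (val : 'I_n + G -> cube n -> bool) (f : boolfun n) (i0 : 'I_n).
Hypothesis val_input : forall i x, val (inl i) x = x i.

Implicit Types (A Ds K X Y : {set G}) (T : {set cube n}) (u r : 'I_n + G) (g h d : G).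

(** The shift makes [node_rank u <= rk g] say that [u] strictly precedes the gate [g]. *)
Definition node_rank u := if u is inr g then (rk g).+1 else 0.

Definition active A u := if u is inr g then g \in A else true.

(** [wphi] allows the output gate to be replaced by a function of an earlier node. *)
Record wiring := Wiring {
  wop : G -> bool -> bool -> bool;
  win1 : G -> 'I_n + G;
  win2 : G -> 'I_n + G;
  wout : 'I_n + G;
  wphi : bool -> bool }.

Implicit Types W : wiring.

(* The gates keep their values as functions on the cube. Only the set [A] of
   gates still in use, the region [T] and the wires change. *)
Definition realizes A T W :=
  [/\ {in A, forall g, [/\ active A (win1 W g), active A (win2 W g),
        node_rank (win1 W g) <= rk g, node_rank (win2 W g) <= rk g &
        {in T, forall x,
           val (inr g) x = wop W g (val (win1 W g) x) (val (win2 W g) x)}]},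
      active A (wout W) & {in T, forall x, f x = wphi W (val (wout W) x)}].

Definition succs A W g : {set G} :=
  [set h in A | (win1 W h == inr g) || (win2 W h == inr g)].

(** Such a gate can be bypassed: its successors read [r] instead and absorb [phi] into their
    operations. A constant gate has a constant [phi]. *)
Definition resolved A Ds T g := exists r phi,
  [/\ active (A :\: Ds) r, node_rank r <= rk g &
      {in T, forall x, val (inr g) x = phi (val r x)}].

Lemma succs_rk A T W g h : realizes A T W -> h \in succs A W g -> rk g < rk h.
Proof.
move=> [wA _ _]; rewrite inE => /andP[/wA[_ _ r1 r2 _]].
by case/orP=> /eqP e; [move: r1|move: r2]; rewrite e.
Qed.

(** Gates of [X] are bypassed; gates of [Ds] are dead, since only removed gates read them. The node
    [r] that replaces a gate of [X] may lie in [X] again, but its rank is smaller, so repeated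
    replacement ends. *)
Lemma eliminate A T W T' X Ds : realizes A T W -> T' \subset T ->
  {in X, forall g, resolved A Ds T' g} ->
  {in Ds, forall d, wout W != inr d /\ succs A W d \subset X :|: Ds} ->
  exists W', realizes (A :\: (X :|: Ds)) T' W'.
Proof.
move=> [wA ao fo] /subsetP sT resX deadD; set A' := A :\: _.
have res u : active (A :\: Ds) u -> exists p : ('I_n + G) * (bool -> bool),
    [/\ active A' p.1, node_rank p.1 <= node_rank u &
        {in T', forall x, val u x = p.2 (val p.1 x)}].
  have [m] := ubnP (node_rank u); elim: m u => // m IHm [i|g] lm.
    by exists (inl i, id).
  move=> aug; have [gX|gX] := boolP (g \in X); last first.
    by exists (inr g, id); split=> //=; move: aug; rewrite /= !inE (negbTE gX).
  have [r [phi [ar rr vr]]] := resX _ gX.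
  have [|[r' psi] [/= ar' rr' vr']] := IHm r _ ar; first exact: leq_ltn_trans rr _.
  exists (r', phi \o psi); split=> //=.
    by apply: leq_trans rr' _; apply: leq_trans rr _.
  by move=> x xT; rewrite vr // vr'.
have notdead u g : g \in A' -> (u == win1 W g) || (u == win2 W g) ->
    active (A :\: Ds) u.
  move=> gA' ug; have gA : g \in A by move: gA'; rewrite inE => /andP[].
  have [a1 a2 _ _ _] := wA g gA.
  have au : active A u by case/orP: ug => /eqP->.
  case: u au ug => // d /= dA ug; rewrite inE dA andbT; apply/negP => dD.
  have [_ /subsetP/(_ g)] := deadD d dD.
  rewrite inE gA /= (eq_sym (win1 W g)) (eq_sym (win2 W g)) => /(_ ug) gX.
  by move: gA'; rewrite inE gX.
have /choice[F HF] : forall g, exists p : (('I_n + G) * (bool -> bool)) *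
    (('I_n + G) * (bool -> bool)), g \in A' ->
    [/\ active A' p.1.1, active A' p.2.1, node_rank p.1.1 <= rk g,
        node_rank p.2.1 <= rk g & {in T', forall x,
        val (inr g) x = wop W g (p.1.2 (val p.1.1 x)) (p.2.2 (val p.2.1 x))}].
  move=> g; have [gA'|ngA'] := boolP (g \in A'); last first.
    by exists ((inl i0, id), (inl i0, id)).
  have gA : g \in A by move: gA'; rewrite inE => /andP[].
  have [_ _ r1 r2 vg] := wA g gA.
  have [|p1 [q1 q2 q3]] := res (win1 W g); first by apply: notdead gA' _; rewrite eqxx.
  have [|p2 [c1 c2 c3]] := res (win2 W g).
    by apply: notdead gA' _; rewrite eqxx orbT.
  exists (p1, p2) => _; split=> //=.
  - exact: leq_trans q2 r1.
  - exact: leq_trans c2 r2.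
  - by move=> x xT; rewrite vg ?sT // q3 // c3.
have [|po [ap _ ep]] := res (wout W).
  case e: (wout W) ao => [i|d] //= dA; rewrite inE dA andbT; apply/negP => dD.
  by have [] := deadD d dD; rewrite e eqxx.
exists (Wiring (fun g a b => wop W g ((F g).1.2 a) ((F g).2.2 b))
  (fun g => (F g).1.1) (fun g => (F g).2.1) po.1 (wphi W \o po.2)).
split=> //=.
by move=> x xT; rewrite fo ?sT // ep.
Qed.

Definition const_on T g := exists c, {in T, forall x, val (inr g) x = c}.

(** A constant gate makes each successor a function of its other input, so the successors are
    bypassed as well. *)
Lemma eliminate_consts A T W T' K X Ds : realizes A T W -> T' \subset T ->
  {in K, forall g, const_on T' g} -> {in X, forall g, resolved A Ds T' g} ->
  {in Ds, forall d, wout W != inr d /\ succs A W d \subset K :|: Ds} ->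
  exists W', realizes
    (A :\: (K :|: X :|: Ds :|: \bigcup_(k in K) succs A W k)) T' W'.
Proof.
move=> rW sT cK rX dD; set U := \bigcup_(k in K) _.
have -> : K :|: X :|: Ds :|: U = ((K :|: X :|: U) :\: Ds) :|: Ds.
  by apply/setP => g; rewrite !inE; case: (g \in K); case: (g \in X);
    case: (g \in Ds); case: (g \in U).
apply: (eliminate rW sT) => [g|d /dD[-> /subsetP sd]]; last first.
  split=> //; apply/subsetP => h /sd; rewrite !inE.
  by case: (h \in K); case: (h \in Ds).
rewrite inE => /andP[gD]; rewrite !inE -orbA => /or3P[/cK[c vc]|/rX//|].
  by exists (inl i0), (fun=> c).
move=> /bigcupP[k kK]; rewrite inE => /andP[gA gk].
have [wA _ _] := rW; have [a1 a2 r1 r2 vg] := wA g gA.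
have [gK|gK] := boolP (g \in K).
  by have [c vc] := cK g gK; exists (inl i0), (fun=> c).
have nd u : active A u -> (u == win1 W g) || (u == win2 W g) ->
    active (A :\: Ds) u.
  case: u => // d /= dA ug; rewrite inE dA andbT; apply/negP => dDs.
  have [_ /subsetP/(_ g)] := dD d dDs.
  rewrite inE gA /= (eq_sym (win1 W g)) (eq_sym (win2 W g)) => /(_ ug).
  by rewrite inE (negbTE gK) (negbTE gD).
have [c vc] := cK k kK; case/orP: gk => /eqP e.
  exists (win2 W g), (wop W g c); split=> //.
    by apply: nd => //; rewrite eqxx orbT.
  by move=> x xT; rewrite vg ?(subsetP sT) // e vc.
exists (win1 W g), (fun a => wop W g a c); split=> //.
  by apply: nd => //; rewrite eqxx.
by move=> x xT; rewrite vg ?(subsetP sT) // e vc.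
Qed.

Lemma realizes_const T c : {in T, forall x, f x = c} ->
  exists W, realizes set0 T W.
Proof.
move=> fc; exists (Wiring (fun _ _ _ => true) (fun=> inl i0) (fun=> inl i0)
  (inl i0) (fun=> c)).
by split=> // g; rewrite inE.
Qed.

(** Depth at most [k] in the current wiring; holding at [k.+1] and failing at [k] means depth
    exactly [k.+1]. *)
Fixpoint low W (k : nat) u : bool :=
  match u with
  | inl _ => true
  | inr g => if k is k'.+1 then low W k' (win1 W g) && low W k' (win2 W g)
             else false
  end.

Lemma low_input W k i : low W k (inl i).
Proof. by case: k. Qed.

Lemma lowS W k u : low W k u -> low W k.+1 u.
Proof.
elim: k u => [|k IHk] [i|g] // /andP[l1 l2].
by apply/andP; split; apply: IHk.
Qed.

Lemma low_le W k k' u : k <= k' -> low W k u -> low W k' u.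
Proof. by move=> /subnK <-; elim: (k' - k) => // m IHm /IHm/lowS. Qed.

Lemma low_represents A T W k u : realizes A T W -> active A u -> low W k u ->
  represents (2 ^ k) T (val u).
Proof.
move=> [wA _ _]; elim: k u => [|k IHk] [i|g] //= au.
- move=> _; have [p sp ep] := represents_var T i; exists p => // x xT.
  by rewrite val_input ep.
- move=> _; apply: (@represents_mono _ 1); first by rewrite expn_gt0.
  have [p sp ep] := represents_var T i; exists p => // x xT.
  by rewrite val_input ep.
- move=> /andP[l1 l2]; have [a1 a2 _ _ vg] := wA g au.
  have [p sp ep] := represents_op (wop W g) (IHk _ a1 l1) (IHk _ a2 l2).
  exists p; first by rewrite expnS mul2n -addnn.
  by move=> x xT; rewrite ep // vg.
Qed.

Lemma low_pred A T W k g : realizes A T W -> g \in A ->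
  ~~ low W k.+1 (inr g) -> low W k.+2 (inr g) ->
  exists h, [/\ h \in A, g \in succs A W h, ~~ low W k (inr h)
    & low W k.+1 (inr h)].
Proof.
move=> [wA _ _] gA nl /andP[l1 l2]; have [a1 a2 _ _ _] := wA g gA.
move: nl; rewrite /= negb_and => /orP[] nl.
  case e: (win1 W g) a1 l1 nl => [i|h] hA l1 nl; first by rewrite low_input in nl.
  by exists h; split=> //; rewrite inE gA e eqxx.
case e: (win2 W g) a2 l2 nl => [i|h] hA l2 nl; first by rewrite low_input in nl.
by exists h; split=> //; rewrite inE gA e eqxx orbT.
Qed.

(** * The fraction of ones kept by the guesses *)

Variables (R : realFieldType) (b : R).
Hypotheses (b_gt0 : (0 < b)%R) (b_le1 : (b <= 1)%R).
Hypotheses (b44 : (b ^+ 4 + b ^+ 4 <= 1)%R) (b35 : (b ^+ 3 + b ^+ 5 <= 1)%R).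

(** [a] is the number of gates left. Every guess is paid for by at least three gates, and the extra
    3 pays for the final equation on the output. Each gate costs a factor [b] of the ones. Size 17
    means degree 16. *)
Definition covered (a : nat) T := exists ps : seq (mpoly.mpoly n 'F_2),
  [/\ 3 * size ps <= a + 3, {in ps, forall p, mpoly.msize p <= 17},
      {in T, forall x, x \in zeros ps -> f x} &
      (b ^+ a * #|T :&: [set x | f x]|%:R <= #|T :&: zeros ps|%:R)%R].

Lemma covered_mono a a' T : a <= a' -> covered a T -> covered a' T.
Proof.
move=> aa' [ps [sp dp fp cp]]; exists ps; split=> //.
  by apply: leq_trans sp _; rewrite leq_add2r.
apply: le_trans cp; apply: ler_wpM2r; first exact: ler0n.
by apply: ler_wiXn2l => //; apply: ltW.
Qed.

(** If both branches were too poor, [T] would have fewer ones than a fraction [b ^+ e1 + b ^+ e0],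
    at most 1, of its own. So one branch is rich enough, and the equation defining it is added. *)
Lemma covered_branch a a0 a1 e0 e1 T (h : cube n -> bool) : represents 16 T h ->
  covered a1 (T :&: [set x | h x == true]) ->
  covered a0 (T :&: [set x | h x == false]) ->
  a1 + e1 <= a -> a0 + e0 <= a -> 3 <= e1 -> 3 <= e0 ->
  (b ^+ e1 + b ^+ e0 <= 1)%R -> covered a T.
Proof.
move=> rh cov1 cov0 le1 le0 g1 g0 eb.
pose Tc c := T :&: [set x | h x == c].
have main c ac ec : covered ac (Tc c) -> ac + ec <= a -> 3 <= ec ->
    (b ^+ a * #|T :&: [set x | f x]|%:R <=
     b ^+ ac * #|Tc c :&: [set x | f x]|%:R)%R -> covered a T.
  move=> [ps [sp dp fp cp]] lec gc big.
  have [p dp1 ep] := represents_zero (represents_unary (fun y => y == c) rh).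
  have eT : T :&: zeros (p :: ps) = Tc c :&: zeros ps.
    apply/setP => x; rewrite !inE /=; case xT: (x \in T) => //=.
    by rewrite ep.
  exists (p :: ps); split.
  - by rewrite /=; lia.
  - by move=> q; rewrite inE => /orP[/eqP->//|/dp].
  - move=> x xT xz; have : x \in T :&: zeros (p :: ps) by rewrite inE xT.
    by rewrite eT inE => /andP[xTc xz']; apply: fp xTc xz'.
  - by rewrite eT; apply: le_trans cp.
have [big1|small1] := leP (b ^+ a * #|T :&: [set x | f x]|%:R)%R
  (b ^+ a1 * #|Tc true :&: [set x | f x]|%:R)%R.
  exact: main cov1 le1 g1 big1.
have [big0|small0] := leP (b ^+ a * #|T :&: [set x | f x]|%:R)%R
  (b ^+ a0 * #|Tc false :&: [set x | f x]|%:R)%R.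
  exact: main cov0 le0 g0 big0.
exfalso; set N := #|T :&: [set x | f x]| in small1 small0.
have small ac ec (M : nat) : ac + ec <= a ->
    (b ^+ ac * M%:R < b ^+ a * N%:R)%R -> (M%:R < b ^+ ec * N%:R)%R.
  move=> le; rewrite -(subnKC (leq_trans (leq_addr _ _) le)) exprD -mulrA.
  rewrite ltr_pM2l ?exprn_gt0 // => /lt_le_trans; apply.
  apply: ler_wpM2r; first exact: ler0n.
  by apply: ler_wiXn2l; [exact: ltW|by []|lia].
have s1 := small _ _ _ le1 small1; have s0 := small _ _ _ le0 small0.
have eN : N = #|Tc true :&: [set x | f x]| + #|Tc false :&: [set x | f x]|.
  rewrite /N -(cardsID [set x | h x == true] (T :&: _)); congr (_ + _);
    apply: eq_card => x; rewrite !inE.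
    by rewrite -!andbA [(f x) && _]andbC.
  by rewrite -!andbA; case: (h x); rewrite /= ?andbT ?andbF.
have := ltrD s1 s0; rewrite -natrD -eN -mulrDl => /lt_le_trans H.
have := H N%:R%R; rewrite ltxx => Hf; suff : false by [].
by apply: Hf; rewrite -[leRHS]mul1r; apply: ler_wpM2r; [exact: ler0n|].
Qed.

Lemma card_eliminated A Y (Z : {set G}) e : Y \subset A -> Y \subset Z -> e <= #|Y| ->
  #|A :\: Z| + e <= #|A|.
Proof.
move=> sA sZ eY; rewrite -(cardsID Z A) addnC leq_add2r.
by apply: leq_trans eY _; apply: subset_leq_card; rewrite subsetI sA.
Qed.

(** Induction on the number of gates. Gates removable without a guess go first. Then [v1] to [v5]
    form a chain of gates of depths exactly 1 to 5, and the guess falls on [v2], [v3] or [v4],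
    depending on the fan-outs and on the type of [v2]. *)
Lemma realizes_covered A T W : realizes A T W -> covered #|A| T.
Proof.
have [m] := ubnP #|A|; elim: m A T W => // m IHm A T W; rewrite ltnS => leA rW.
have IH A' T' W' : #|A'| < #|A| -> realizes A' T' W' -> covered #|A'| T'.
  by move=> lt; apply: IHm; apply: leq_trans lt leA.
have [wA ao fo] := rW.
have [lo|nlo] := boolP (low W 4 (wout W)).
  have [p sp ep] := represents_zero (represents_unary (wphi W)
    (low_represents rW ao lo)).
  exists [:: p]; split; first by rewrite leq_addl.
  - by move=> q; rewrite inE => /eqP->.
  - by move=> x xT; rewrite inE /= ep // andbT fo.
  - rewrite (_ : T :&: zeros [:: p] = T :&: [set x | f x]); last first.
      apply/setP => x; rewrite !inE /= andbT; case xT: (x \in T) => //=.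
      by rewrite ep // fo.
    rewrite -[leRHS]mul1r; apply: ler_wpM2r; first exact: ler0n.
    by apply: exprn_ile1 => //; apply: ltW.
have [[g gA rg]|nres] := pselect (exists2 g, g \in A & resolved A set0 T g).
  have [|d|W' rW'] := @eliminate A T W T [set g] set0 rW (subxx _).
  - by move=> g' /set1P->.
  - by rewrite inE.
  have lt : #|A :\: ([set g] :|: set0)| < #|A|.
    by rewrite setU0 -addn1; apply: (@card_eliminated _ [set g]);
      rewrite ?sub1set ?cards1 ?set11.
  by apply: covered_mono (ltnW lt) (IH _ _ _ lt rW').
have [[g [gA go sg]]|ndead] :=
    pselect (exists g, [/\ g \in A, wout W != inr g & succs A W g = set0]).
  have [g'|d|W' rW'] := @eliminate A T W T set0 [set g] rW (subxx _).
  - by rewrite inE.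
  - by move=> /set1P->; rewrite sg sub0set.
  have lt : #|A :\: (set0 :|: [set g])| < #|A|.
    by rewrite set0U -addn1; apply: (@card_eliminated _ [set g]);
      rewrite ?sub1set ?cards1 ?set11.
  by apply: covered_mono (ltnW lt) (IH _ _ _ lt rW').
have succ_ex g : g \in A -> wout W != inr g -> exists h, h \in succs A W g.
  by move=> gA go; apply/set0Pn/eqP => sg; apply: ndead; exists g.
have sA g : succs A W g \subset A.
  by apply/subsetP => h; rewrite inE => /andP[].
have nsucc g h : rk g <= rk h -> g \notin succs A W h.
  by move=> le; apply/negP => /(succs_rk rW); rewrite ltnNge le.
have neq_rk g h : rk g < rk h -> g != h.
  by move=> lt; apply: contraTneq lt => ->; rewrite ltnn.
have notout g : low W 4 (inr g) -> wout W != inr g.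
  by move=> lg; apply: contraNneq nlo => ->.
pose Tv v c := T :&: [set x | val (inr v) x == c].
have sTv v c : Tv v c \subset T by apply: subsetIl.
have vTv v c : {in Tv v c, forall x, val (inr v) x = c}.
  by move=> x; rewrite !inE => /andP[_ /eqP].
pose reduces T' e := exists A' W', realizes A' T' W' /\ #|A'| + e <= #|A|.
have elim T' K X Ds Y e : T' \subset T -> {in K, forall g, const_on T' g} ->
    {in X, forall g, resolved A Ds T' g} ->
    {in Ds, forall d, wout W != inr d /\ succs A W d \subset K :|: Ds} ->
    Y \subset A ->
    {in Y, forall y, [\/ y \in K, y \in X, y \in Ds
                       | exists2 k, k \in K & y \in succs A W k]} ->
    e <= #|Y| -> reduces T' e.
  move=> sT cK rX dD YA YZ eY; have [W' rW'] := eliminate_consts rW sT cK rX dD.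
  eexists; exists W'; split; first exact: rW'.
  apply: (card_eliminated YA) eY; apply/subsetP => y /YZ; rewrite !inE.
  move=> [->|->|->|[k kK yk]]; rewrite ?orbT //.
  by apply/orP; right; apply/bigcupP; exists k.
have guess v e1 e0 : v \in A -> low W 4 (inr v) -> 3 <= e1 -> 3 <= e0 ->
    (b ^+ e1 + b ^+ e0 <= 1)%R -> reduces (Tv v true) e1 ->
    reduces (Tv v false) e0 -> covered #|A| T.
  move=> vA lv g1 g0 be [A1 [W1 [rW1 c1]]] [A0 [W0 [rW0 c0]]].
  have rep : represents 16 T (val (inr v)) := low_represents rW (u := inr v) vA lv.
  apply: (covered_branch rep (IH _ _ _ _ rW1) (IH _ _ _ _ rW0) c1 c0) => //.
    by apply: leq_trans c1; rewrite -addn1 leq_add2l (leq_trans _ g1).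
  by apply: leq_trans c0; rewrite -addn1 leq_add2l (leq_trans _ g0).
have guess4 v : v \in A -> low W 4 (inr v) -> (forall c, reduces (Tv v c) 4) ->
    covered #|A| T.
  by move=> vA lv H; apply: (guess v 4 4).
have types g : g \in A -> win1 W g != win2 W g /\
    ((exists c, forall p q, wop W g p q = p (+) q (+) c) \/
     (exists c p0 q0, forall p q, wop W g p q = c -> p = p0 /\ q = q0)).
  move=> gA; have [a1 a2 r1 r2 vg] := wA g gA; split.
    apply/eqP => e; apply: nres; exists g => //.
    exists (win1 W g), (fun a => wop W g a a); rewrite setD0; split=> // x xT.
    by rewrite vg // e.
  case: (binary_op_cases (wop W g)) => [[phi H]|[phi H]|[c H]|H]; [| |left|right] => //.
  - case: nres; exists g => //; exists (win1 W g), phi; rewrite setD0.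
    by split=> // x xT; rewrite vg.
  - case: nres; exists g => //; exists (win2 W g), phi; rewrite setD0.
    by split=> // x xT; rewrite vg.
  - by exists c.
(* The first gate in the order [rk] whose depth exceeds 4 has depth exactly 5. *)
have [v5 [v5A nl5 l5]] : exists v, [/\ v \in A, ~~ low W 4 (inr v) & low W 5 (inr v)].
  case eo: (wout W) ao nlo => [i|g0] g0A nlo; first by rewrite low_input in nlo.
  have P0 : (g0 \in A) && ~~ low W 4 (inr g0) by apply/andP.
  case: (@arg_minnP _ g0 (fun g => (g \in A) && ~~ low W 4 (inr g)) rk P0).
  move=> v /andP[vA nlv] vmin; exists v; split=> //.
  have [a1 a2 r1 r2 _] := wA v vA.
  have lowu u : active A u -> node_rank u <= rk v -> low W 4 u.
    case: u => [i|h] //= hA hv; apply/negPn/negP => nl.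
    by have := vmin h; rewrite hA /= => /(_ nl); rewrite leqNgt hv.
  by apply/andP; split; apply: lowu.
have [v4 [v4A s45 nl4 l4]] := low_pred rW v5A nl5 l5.
have [v3 [v3A s34 nl3 l3]] := low_pred rW v4A nl4 l4.
have [v2 [v2A s23 nl2 l2]] := low_pred rW v3A nl3 l3.
have [v1 [v1A s12 _ l1]] := low_pred rW v2A nl2 l2.
have {}l3 : low W 4 (inr v3) by apply: lowS.
have {}l2 : low W 4 (inr v2) by apply: (low_le _ l2).
have {}l1 : low W 4 (inr v1) by apply: (low_le _ l1).
have r12 := succs_rk rW s12; have r23 := succs_rk rW s23.
have r34 := succs_rk rW s34; have r45 := succs_rk rW s45.
have r13 := ltn_trans r12 r23; have r24 := ltn_trans r23 r34.
have const1 v c : {in [set v], forall g, const_on (Tv v c) g}.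
  by move=> g /set1P->; exists c; apply: vTv.
have noX T' Ds : {in set0, forall g, resolved A Ds T' g} by move=> g; rewrite inE.
have [one2|two2] := leqP #|succs A W v2| 1.
  have e2 : succs A W v2 = [set v3].
    by apply/esym/eqP; rewrite eqEcard sub1set s23 cards1.
  have [one3|two3] := leqP #|succs A W v3| 1.
    have e3 : succs A W v3 = [set v4].
      by apply/esym/eqP; rewrite eqEcard sub1set s34 cards1.
    (* Once [v4] is constant, [v3] and then [v2] are dead; a successor of [v4] is the fourth
       gate. *)
    apply: (guess4 v4) => // c.
    apply: (elim _ [set v4] set0 [set v2; v3] (v2 |: (v3 |: (v4 |: succs A W v4)))) => //.
    + move=> d /set2P[]->; split; [exact: notout| |exact: notout|].
        by rewrite e2 sub1set !inE eqxx !orbT.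
      by rewrite e3 sub1set !inE eqxx.
    + by rewrite !subUset !sub1set v2A v3A v4A sA.
    + move=> y; rewrite !in_setU1 => /or4P[/eqP->|/eqP->|/eqP->|yk].
      * by apply: Or43; rewrite !inE eqxx.
      * by apply: Or43; rewrite !inE eqxx orbT.
      * by apply: Or41; rewrite inE.
      * by apply: Or44; exists v4; rewrite ?set11.
    + have s4 : 0 < #|succs A W v4| by apply/card_gt0P; exists v5.
      by rewrite !cardsU1 !in_setU1 !negb_or !neq_rk // !nsucc //; apply: ltnW.
  apply: (guess4 v3) => // c.
  apply: (elim _ [set v3] set0 [set v2] (v2 |: (v3 |: succs A W v3))) => //.
  + move=> d /set1P->; split; first exact: notout.
    by rewrite e2 sub1set !inE eqxx.
  + by rewrite !subUset !sub1set v2A v3A sA.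
  + move=> y; rewrite !in_setU1 => /or3P[/eqP->|/eqP->|yk].
    * by apply: Or43; rewrite inE.
    * by apply: Or41; rewrite inE.
    * by apply: Or44; exists v3; rewrite ?set11.
  + by rewrite !cardsU1 !in_setU1 !negb_or !neq_rk // !nsucc //; apply: ltnW.
have [n12 ty] := types v2 v2A; have [a1 a2 q1 q2 vg] := wA v2 v2A.
have vgT c x : x \in Tv v2 c ->
    c = wop W v2 (val (win1 W v2) x) (val (win2 W v2) x).
  by move=> xT; rewrite -(vTv _ _ _ xT) vg // (subsetP (sTv v2 c)).
case: ty => [[c0 xor]|[c0 [p0 [q0 and]]]].
  (* The constraint [v2 = c] makes the two inputs of [v2] equal up to negation,
     so the one that is computed later can be dropped. *)
  apply: (guess4 v2) => // c.
  have [e [eA re rese]] : exists e, [/\ e \in A, rk e < rk v2 &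
      resolved A set0 (Tv v2 c) e].
    have vv x : x \in Tv v2 c ->
        val (win1 W v2) x = val (win2 W v2) x (+) (c (+) c0).
      move=> xT; have := vgT c x xT; rewrite xor => ->.
      by case: (val _ x); case: (val _ x); case: (c0).
    have [lt|gt|eq] := ltngtP (node_rank (win1 W v2)) (node_rank (win2 W v2)).
    + case e2: (win2 W v2) => [i|e]; first by rewrite e2 in lt.
      exists e; split; [by move: a2; rewrite e2|by move: q2; rewrite e2|].
      exists (win1 W v2), (fun a => a (+) (c (+) c0)); rewrite setD0; split=> //.
        by move: lt; rewrite e2.
      by move=> x xT; rewrite vv // e2 -addbA addbb addbF.
    + case e1: (win1 W v2) => [i|e]; first by rewrite e1 in gt.
      exists e; split; [by move: a1; rewrite e1|by move: q1; rewrite e1|].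
      exists (win2 W v2), (fun a => a (+) (c (+) c0)); rewrite setD0; split=> //.
        by move: gt; rewrite e1.
      by move=> x xT; rewrite -vv // e1.
    (* Distinct nodes of equal rank are both input nodes, as [rk] is injective, but [v2] reads the
       gate [v1]. *)
    + exfalso; move: s12; rewrite inE v2A /=.
      case: (win1 W v2) (win2 W v2) n12 eq => [i|e] [j|e'] //= ne [].
      by move/rk_inj => e_eq; rewrite e_eq eqxx in ne.
  apply: (elim _ [set v2] [set e] set0 (e |: (v2 |: succs A W v2))) => //.
  + by move=> g /set1P->.
  + by move=> d; rewrite inE.
  + by rewrite !subUset !sub1set eA v2A sA.
  + move=> y; rewrite !in_setU1 => /or3P[/eqP->|/eqP->|yk].
    * by apply: Or42; rewrite inE.
    * by apply: Or41; rewrite inE.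
    * by apply: Or44; exists v2; rewrite ?set11.
  + by rewrite !cardsU1 !in_setU1 !negb_or !neq_rk // !nsucc //; apply: ltnW.
have plain c e : e <= #|succs A W v2|.+1 -> reduces (Tv v2 c) e.
  move=> le; apply: (elim _ [set v2] set0 set0 (v2 |: succs A W v2)) => //.
  + by move=> d; rewrite inE.
  + by rewrite !subUset !sub1set v2A sA.
  + move=> y; rewrite !in_setU1 => /orP[/eqP->|yk].
    * by apply: Or41; rewrite inE.
    * by apply: Or44; exists v2; rewrite ?set11.
  + by rewrite cardsU1 nsucc.
have [le2|three2] := leqP #|succs A W v2| 2; last first.
  by apply: (guess4 v2) => // c; apply: plain.
have [one1|two1] := leqP #|succs A W v1| 1.
  have e1 : succs A W v1 = [set v2].
    by apply/esym/eqP; rewrite eqEcard sub1set s12 cards1.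
  apply: (guess4 v2) => // c.
  apply: (elim _ [set v2] set0 [set v1] (v1 |: (v2 |: succs A W v2))) => //.
  + move=> d /set1P->; split; first exact: notout.
    by rewrite e1 sub1set !inE eqxx.
  + by rewrite !subUset !sub1set v1A v2A sA.
  + move=> y; rewrite !in_setU1 => /or3P[/eqP->|/eqP->|yk].
    * by apply: Or43; rewrite inE.
    * by apply: Or41; rewrite inE.
    * by apply: Or44; exists v2; rewrite ?set11.
  + by rewrite !cardsU1 !in_setU1 !negb_or !neq_rk // !nsucc //; apply: ltnW.
(* The value [c0] forces both inputs of [v2], so there [v1] is constant too and five gates can go;
   the other branch loses [v2] and its two successors. *)
suff special : reduces (Tv v2 c0) 5.
  case: c0 and special => _ special.
    by apply: (guess v2 5 3) => //; [rewrite addrC|apply: plain].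
  by apply: (guess v2 3 5) => //; apply: plain.
set T' := Tv v2 c0; have sT' : T' \subset T by apply: sTv.
have c2 : const_on T' v2 by exists c0; apply: vTv.
have c1 : const_on T' v1.
  move: s12; rewrite inE v2A /= => /orP[]/eqP e.
    by exists p0 => x xT; rewrite -e; have [] := and _ _ (esym (vgT _ _ xT)).
  by exists q0 => x xT; rewrite -e; have [] := and _ _ (esym (vgT _ _ xT)).
have const_succ g k h : const_on T' g -> const_on T' k -> g != k ->
    h \in succs A W g -> h \in succs A W k -> const_on T' h.
  move=> [cg vg'] [ck vk] gk; rewrite !inE => /andP[hA hg] /andP[_ hk].
  have [_ _ _ _ vh] := wA h hA; have vhT x : x \in T' ->
    val (inr h) x = wop W h (val (win1 W h) x) (val (win2 W h) x).
    by move=> xT; apply: vh; apply: (subsetP (sTv v2 c0)).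
  case/orP: hg => /eqP eg; case/orP: hk => /eqP ek.
  + by move: gk; rewrite -(inj_eq (@inr_inj 'I_n G)) -eg -ek eqxx.
  + by exists (wop W h cg ck) => x xT; rewrite vhT // eg ek vg' // vk.
  + by exists (wop W h ck cg) => x xT; rewrite vhT // eg ek vg' // vk.
  + by move: gk; rewrite -(inj_eq (@inr_inj 'I_n G)) -eg -ek eqxx.
have out_const g : wout W = inr g -> const_on T' g -> reduces T' 5.
  move=> eo [c vc]; have [|W' rW'] := @realizes_const T' (wphi W c).
    by move=> x xT; rewrite fo ?(subsetP (sTv v2 c0)) // eo vc.
  exists set0, W'; split=> //; rewrite cards0 add0n.
  apply: leq_trans (subset_leq_card (_ : [set v1; v2; v3; v4; v5] \subset A)).
    by rewrite -!setUA !cardsU1 !inE !negb_or cards1 !neq_rk //;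
      do ?[exact: ltn_trans r34 r45 | exact: ltn_trans r24 r45
         | exact: ltn_trans r13 r34 | exact: ltn_trans (ltn_trans r13 r34) r45].
  by rewrite -!setUA !subUset !sub1set v1A v2A v3A v4A v5A.
have five K k y : {in K, forall g, const_on T' g} -> v1 \in K -> v2 \in K ->
    k \in K -> y \in succs A W k -> rk v2 < rk y -> y \notin succs A W v2 ->
    reduces T' 5.
  move=> cK v1K v2K kK yk ry ny.
  apply: (elim _ K set0 set0 (v1 |: (v2 |: (y |: succs A W v2)))) => //.
  + by move=> d; rewrite inE.
  + by rewrite !subUset !sub1set v1A v2A sA (subsetP (sA k)).
  + move=> z; rewrite !in_setU1 => /or4P[/eqP->|/eqP->|/eqP->|zk].
    * exact: Or41.
    * exact: Or41.
    * by apply: Or44; exists k.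
    * by apply: Or44; exists v2.
  + rewrite !cardsU1 !in_setU1 !negb_or !neq_rk ?(ltn_trans r12 ry) // ny.
    by rewrite !nsucc //; apply: ltnW.
(* Besides [v1], [v2] and two successors of [v2], the fifth gate is one that reads a constant gate
   but not [v2]: [h]; or, if [v2] also feeds [h] and makes it constant, a successor [k] of [h]; or,
   if [k] becomes constant in the same way, a successor [y] of [k]. *)
have [h hs1 nh2] : exists2 h, h \in succs A W v1 & h != v2.
  have /card_gt0P[h] : 0 < #|succs A W v1 :\ v2|.
    by move: two1; rewrite (cardsD1 v2) s12.
  by rewrite in_setD1 => /andP[nh hs]; exists h.
have hA : h \in A by apply: (subsetP (sA v1)).
have [hs2|nhs2] := boolP (h \in succs A W v2); last first.
  have K12 : {in [set v1; v2], forall g, const_on T' g}.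
    by move=> g; rewrite !inE => /orP[]/eqP->.
  have [lt|gt|eq] := ltngtP (rk v2) (rk h).
  + by apply: (five [set v1; v2] v1 h) => //; rewrite !inE eqxx ?orbT.
  + apply: (elim _ [set v1; v2] set0 set0 (v1 |: (h |: (v2 |: succs A W v2)))) => //.
    * by move=> d; rewrite inE.
    * by rewrite !subUset !sub1set v1A v2A sA hA.
    * move=> z; rewrite !in_setU1 => /or4P[/eqP->|/eqP->|/eqP->|zk].
      - by apply: Or41; rewrite !inE eqxx.
      - by apply: Or44; exists v1; rewrite // !inE eqxx.
      - by apply: Or41; rewrite !inE eqxx orbT.
      - by apply: Or44; exists v2; rewrite // !inE eqxx orbT.
    * have r1h := succs_rk rW hs1.
      by rewrite !cardsU1 !in_setU1 !negb_or !neq_rk // !nsucc //; apply: ltnW.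
  + by rewrite (rk_inj eq) eqxx in nh2.
have r2h := succs_rk rW hs2.
have ch : const_on T' h by apply: (const_succ v1 v2) => //; apply: neq_rk.
have K3 : {in [set v1; v2; h], forall g, const_on T' g}.
  by move=> g; rewrite !inE -orbA => /or3P[]/eqP->.
have [eo|no] := eqVneq (wout W) (inr h); first exact: out_const eo ch.
have [k ks] := succ_ex h hA no; have rhk := succs_rk rW ks.
have [ks2|nks2] := boolP (k \in succs A W v2); last first.
  by apply: (five [set v1; v2; h] h k) => //; rewrite ?inE ?eqxx ?orbT //;
    apply: ltn_trans r2h rhk.
have ck : const_on T' k by apply: (const_succ v2 h) => //; apply: neq_rk.
have [eo|no'] := eqVneq (wout W) (inr k); first exact: out_const eo ck.
have kA : k \in A by apply: (subsetP (sA h)).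
have [y ys] := succ_ex k kA no'; have rky := succs_rk rW ys.
have e2 : succs A W v2 = [set h; k].
  apply/esym/eqP; rewrite eqEcard subUset !sub1set hs2 ks2 cards2 neq_rk //.
apply: (five [set v1; v2; h; k] k y) => //; try by rewrite !inE eqxx ?orbT.
- by move=> g; rewrite !inE -!orbA => /or4P[]/eqP->.
- exact: ltn_trans r2h (ltn_trans rhk rky).
- by rewrite e2 !inE negb_or ![y == _]eq_sym !neq_rk // (ltn_trans rhk).
Qed.

End Elimination.

(** * Asymptotics *)

Local Open Scope classical_set_scope.
Local Open Scope ring_scope.

Lemma disperser_zeros_log (R : realType) n (f : boolfun n) (d y : R) m ps :
  disperser d m (2 `^ y) f -> ((size ps)%:R%:E <= m)%E ->
  {in ps, forall p, (mpoly.msize p).-1%:R <= d} ->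
  {in zeros ps, forall x, f x} ->
  (0 < #|zeros ps|)%N -> ln (#|zeros ps|%:R : R) <= y * ln 2.
Proof.
move=> df sm dp f1 z0; rewrite -ln_powR ler_ln ?posrE ?ltr0n ?powR_gt0 //.
exact: disperser_zeros df sm dp f1.
Qed.

Lemma ln2_gt0 (R : realType) : 0 < ln (2 : R).
Proof. by apply: ln_gt0; lra. Qed.

Lemma ln2_ge_half (R : realType) : 1 / 2 <= ln (2 : R).
Proof.
have : ln (1 + - (1 / 2) : R) <= - (1 / 2) by apply: le_ln1Dx; lra.
have -> : 1 + - (1 / 2) = 2^-1 :> R by lra.
by rewrite lnV ?posrE ?ltr0n //; lra.
Qed.

Lemma ln_exprn (R : realType) (x : R) n : 0 < x -> ln (x ^+ n) = n%:R * ln x.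
Proof. by move=> x0; rewrite lnXn // mulr_natl. Qed.

(** Compares logarithms of the lower bound from the popular guess and the upper bound from the
    disperser; the extra 1 is the factor lost to [majority_one]. *)
Lemma guess_disperser (R : realType) n (C : circuit n) (f : boolfun n)
    (B : {set node C}) (psi : node C -> nat) (k : nat) (d y : R) m :
  computes C f -> majority_one f ->
  (forall u v, wire u v -> u \notin B -> (psi u < psi v)%N) ->
  (forall v, (psi v < k)%N) -> (2 ^ k)%:R <= d ->
  ((#|B|.+1)%:R%:E <= m)%E -> disperser d m (2 `^ y) f ->
  n%:R <= #|B|.+1%:R + y.
Proof.
move=> Cf mf psi_lt psik kd Bm df.
have [ps [sp dp f1 cf]] := guess_zeros Cf psi_lt psik.
have big : (2 ^ n <= 2 ^ #|B|.+1 * #|zeros ps|)%N.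
  apply: leq_trans (majority_card mf) _.
  by rewrite expnS -mulnA leq_mul2l.
have z0 : (0 < #|zeros ps|)%N.
  by have := leq_trans (expn_gt0 2 n) big; rewrite muln_gt0 => /andP[].
have small : ln (#|zeros ps|%:R : R) <= y * ln 2.
  apply: disperser_zeros_log df _ _ f1 z0; first by rewrite sp.
  move=> p /dp pk; apply: le_trans kd; rewrite ler_nat.
  by move: (mpoly.msize p) pk => [|a] //=.
move: big; rewrite -(ler_nat R) natrM !natrX.
rewrite -ler_ln ?posrE ?mulr_gt0 ?exprn_gt0 ?ltr0n //.
rewrite lnM ?posrE ?exprn_gt0 ?ltr0n // !ln_exprn ?ltr0n // => big.
have : n%:R * ln 2 <= (#|B|.+1%:R + y) * ln (2 : R).
  by rewrite mulrDl; apply: le_trans big _; rewrite lerD2l.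
by rewrite ler_pM2r ?ln2_gt0.
Qed.

Lemma exists_natr_gt (R : realType) (x : R) :
  exists2 K : nat, (0 < K)%N & x < K%:R.
Proof.
exists (Num.truncn `|x|).+1 => //; apply: le_lt_trans (ler_norm x) _.
by have /truncn_itv/andP[] := normr_ge0 x.
Qed.

Lemma log2_gtE (R : realType) (x M : R) : 0 < x -> (M < log2 x) = (2 `^ M < x).
Proof.
move=> x0; rewrite /log2 ltr_pdivlMr ?ln2_gt0 // -ln_powR.
by rewrite ltr_ln ?posrE ?powR_gt0.
Qed.

Lemma near_log2_gt (R : realType) (M : R) :
  \forall n \near \oo, M < log2 (n%:R : R).
Proof.
near=> n; rewrite log2_gtE; first by near: n; apply: nbhs_infty_gtr.
by rewrite ltr0n; near: n; apply: nbhs_infty_gt.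
Unshelve. all: by end_near. Qed.

Lemma log2_le (R : realType) (x : R) : 0 < x -> log2 x <= 2 * x.
Proof.
move=> x0; rewrite /log2 ler_pdivrMr ?ln2_gt0 //.
have := ln_sublinear x0; have := ln2_ge_half R; nra.
Qed.

(** * The four bounds *)

Lemma circuit_covered (R : realFieldType) (b : R) n (C : circuit n.+1)
    (f : boolfun n.+1) : 0 < b -> b <= 1 -> b ^+ 4 + b ^+ 4 <= 1 ->
  b ^+ 3 + b ^+ 5 <= 1 -> computes C f -> covered f b (csize C) [set: cube n.+1].
Proof.
move=> b0 b1 b44 b35 /computes_value_map[V [V1 V2 V3]].
(* The topological numbering with ties broken by the index of the gate, to make it injective. *)
pose rk (g : 'I_(csize C)) := (wire_rank (inr g : node C) * csize C + g)%N.
have rk_inj : injective rk.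
  move=> g h /(congr1 (fun a => a %% csize C)%N).
  by rewrite !modnMDl !modn_small // => /val_inj.
have rk_lt (u : node C) g : wire u (inr g : node C) ->
    (@node_rank _ _ rk u <= rk g)%N.
  case: u => [i|h] // /wire_rank_lt lt; rewrite /node_rank /rk.
  have : ((wire_rank (inr h : node C)).+1 * csize C <=
          wire_rank (inr g : node C) * csize C)%N by rewrite leq_mul2r lt orbT.
  rewrite mulSn => le; apply: leq_trans (leq_addr g _); apply: leq_trans le.
  by rewrite addnC ltn_add2r.
have real : realizes rk V f [set: 'I_(csize C)] [set: cube n.+1]
    (Wiring (@gate_op _ C) (@gate_in1 _ C) (@gate_in2 _ C) (output C) id).
  have act (u : node C) : active [set: 'I_(csize C)] u by case: u => //= g; rewrite inE.
  split=> [g _|//|x _]; last by rewrite /= V3.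
  split; [exact: act|exact: act| | |].
  - exact/rk_lt/wire_in1.
  - exact/rk_lt/wire_in2.
  - by move=> x _; rewrite V2.
have := realizes_covered rk_inj ord0 V1 b0 b1 b44 b35 real.
by rewrite cardsT card_ord.
Qed.

Lemma size_lower_bound (R : realType) (eps : R) n (f : boolfun n) :
  majority_one f ->
  disperser 16 (13 / 10 * (1 - eps) * n%:R)%:E (2 `^ (eps * n%:R)) f ->
  ((39 / 10 * (1 - eps) * n%:R - 4)%:E <= circuit_complexity R f)%E.
Proof.
move=> mf df; apply: le_ereal_inf_tmp => _ [C Cf <-]; rewrite lee_fin.
case: n f mf df C Cf => [|n] f mf df C Cf.
  by rewrite mulr0; have : 0 <= (csize C)%:R :> R; [exact: ler0n|lra].
rewrite leNgt; apply/negP => small.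
(* A rational meeting both branching inequalities with [b ^+ 39] at least [2 ^- 10]: the guesses
   lose at most one bit per 3.9 gates. *)
pose b : R := 67 / 80.
have [b0 b1 b44 b35] : [/\ 0 < b, b <= 1, b ^+ 4 + b ^+ 4 <= 1
    & b ^+ 3 + b ^+ 5 <= 1] by rewrite /b; split; lra.
have [ps [sp dp f1 cf]] := circuit_covered b0 b1 b44 b35 Cf.
rewrite !setTI in cf.
have M0 : (0 < #|[set x | f x]%SET|)%N.
  have := leq_trans (expn_gt0 2 n.+1) (majority_card mf).
  by rewrite muln_gt0.
have z0 : (0 < #|zeros ps|)%N.
  by rewrite -(ltr0n R); apply: lt_le_trans cf; rewrite mulr_gt0 ?exprn_gt0 ?ltr0n.
have {}sp : 3 * (size ps)%:R <= (csize C)%:R + 3 :> R.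
  by rewrite -natrM -natrD ler_nat.
have lz : ln (#|zeros ps|%:R : R) <= eps * n.+1%:R * ln 2.
  apply: disperser_zeros_log df _ _ _ z0.
  - by rewrite lee_fin; move: sp small; lra.
  - move=> p /dp pk; rewrite ler_nat.
    by move: (mpoly.msize p) pk => [|a] //=.
  - by move=> x; apply: f1; rewrite inE.
have lb : - (10 / 39) * ln 2 <= ln b.
  have : (2^-1) ^+ 10 <= b ^+ 39 by rewrite /b; lra.
  rewrite -ler_ln ?posrE ?exprn_gt0 ?invr_gt0 ?ltr0n //.
  rewrite !ln_exprn ?invr_gt0 ?ltr0n // lnV ?posrE ?ltr0n //.
  by lra.
have := majority_card mf; rewrite -(ler_nat R) natrX natrM.
rewrite -ler_ln ?posrE ?mulr_gt0 ?exprn_gt0 ?ltr0n //.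
rewrite ln_exprn ?ltr0n // lnM ?posrE ?ltr0n // => big.
move: cf; rewrite -ler_ln ?posrE ?mulr_gt0 ?exprn_gt0 ?ltr0n //.
rewrite lnM ?posrE ?exprn_gt0 ?ltr0n // ln_exprn // => cf.
have l2 := ln2_gt0 R; have s0 : 0 <= (csize C)%:R :> R by exact: ler0n.
have key : n.+1%:R * ln 2 - ln 2 - (csize C)%:R * (10 / 39) * ln 2 <=
    eps * n.+1%:R * ln (2 : R).
  apply: le_trans lz; apply: le_trans cf.
  have : (csize C)%:R * (- (10 / 39) * ln 2) <= (csize C)%:R * ln b.
    exact: ler_wpM2l.
  by lra.
have : (n.+1%:R - 1 - (csize C)%:R * (10 / 39)) * ln 2 <=
    (eps * n.+1%:R) * ln (2 : R) by move: key; lra.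
by rewrite ler_pM2r //; lra.
Qed.

Lemma sp_bound (R : realType) (eps : R) (f : forall n, boolfun n) : 0 < eps ->
  (forall n, majority_one (f n)) ->
  (forall (k : nat) (C : R), 0 < C -> \forall n \near \oo,
     disperser k%:R (C * n%:R)%:E (2 `^ ((1 - eps) * n%:R)) (f n)) ->
  sp_superlinear R f.
Proof.
move=> eps0 mf df c.
(* The 8 combines the factor 4 of the cut with the target [eps / 2] for the fraction of guessed
   nodes. *)
have [K K0] := exists_natr_gt (8 * (1 + `|c|) / eps).
rewrite ltr_pdivrMr // => KP.
pose k := (tail_bound K K).*2.+2.
near=> n; move=> [C [Cf spC sC]].
have n0 : 2 < eps * n%:R.
  rewrite mulrC -ltr_pdivrMr //; near: n; exact: nbhs_infty_gtr.
have n1 : 1 <= n%:R :> R by rewrite ler1n; near: n; exact: nbhs_infty_gt.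
have d : disperser (2 ^ k)%:R ((eps / 2 + 1) * n%:R)%:E
    (2 `^ ((1 - eps) * n%:R)) (f n).
  by near: n; apply: df; lra.
have [B [psi [psi_lt psi_le cB]]] := series_parallel_cut K0 spC.
have Bsmall : #|B|%:R <= eps / 2 * n%:R.
  have : K%:R * #|B|%:R <= 4 * (n%:R + (csize C)%:R) :> R.
    by rewrite -natrD -!natrM ler_nat.
  have : (csize C)%:R <= `|c| * n%:R.
    by apply: le_trans sC _; apply: ler_wpM2r; [exact: ler0n|exact: ler_norm].
  have KR0 : 0 < K%:R :> R by rewrite ltr0n.
  move=> h1 h2; rewrite -(ler_pM2l KR0); apply: le_trans h2 _.
  have : 8 * (1 + `|c|) * n%:R <= K%:R * eps * n%:R.
    by apply: ler_wpM2r; [exact: ler0n|exact: ltW].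
  by lra.
have : n%:R <= #|B|.+1%:R + (1 - eps) * n%:R.
  apply: (guess_disperser Cf (mf n) psi_lt (k := k)) d => //.
  by rewrite lee_fin -natr1; lra.
by rewrite -natr1; lra.
Unshelve. all: by end_near. Qed.

(** Rounds the depth up to a power of two, losing at most a factor 2, so that labels are strings of
    [k] binary digits. *)
Lemma depth_levels (R : realType) n (C : circuit n) (D : R) : 1 <= D ->
  depth_le C D -> exists (k : nat) (l : node C -> nat),
    [/\ forall u v, wire u v -> (l u < l v)%N, forall v, (l v < 2 ^ k)%N,
        (2 ^ k)%:R <= 2 * D & D < (2 ^ k)%:R].
Proof.
move=> D1 dC; have /truncn_itv/andP[tD Dt] : 0 <= D by lra.
set t := Num.truncn D in tD Dt.
have t0 : (0 < t)%N.
  by rewrite lt0n; apply: contraTneq Dt => ->; rewrite -leNgt.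
exists (trunc_log 2 t).+1.
have Dk : D < (2 ^ (trunc_log 2 t).+1)%:R.
  by apply: lt_le_trans Dt _; rewrite ler_nat trunc_log_ltn.
have [|l l_lt lL] := depth_label (L := (2 ^ (trunc_log 2 t).+1).-1) dC.
  by rewrite prednK ?expn_gt0.
exists l; split=> //.
  by move=> v; rewrite -(prednK (_ : 0 < 2 ^ _)%N) ?expn_gt0 // ltnS.
rewrite expnS natrM; have : (2 ^ trunc_log 2 t)%:R <= t%:R :> R.
  by rewrite ler_nat trunc_logP.
by lra.
Qed.

Lemma depth_le_norm (R : realType) n (C : circuit n) (c : R) :
  1 < log2 (n%:R : R) -> depth_le C (c * log2 n%:R) ->
  depth_le C ((1 + `|c|) * log2 n%:R).
Proof.
move=> n1 dC i p /dC le; apply: le_trans le _.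
by have := ler_norm c; nra.
Qed.

Lemma size_le_norm (R : realType) n s (c : R) : s%:R <= c * n%:R ->
  s%:R <= (1 + `|c|) * n%:R.
Proof.
move=> le; apply: le_trans le _; apply: ler_wpM2r; first exact: ler0n.
by have := ler_norm c; lra.
Qed.

Lemma leq_double_divM k r : (0 < r)%N -> (2 * r <= k)%N ->
  (k <= 2 * (r * (k %/ r)))%N.
Proof.
move=> r0 rk; have m : (k %% r < r)%N by rewrite ltn_mod.
have : (r <= k %/ r * r)%N by rewrite leq_pmull // divn_gt0 //; lia.
by have := divn_eq k r; lia.
Qed.

Lemma leq_cut_product B k q r s : (k <= 2 * (r * q))%N -> (q * B <= 2 * s)%N ->
  (B * k <= 4 * r * s)%N.
Proof. by move=> h1 h2; nia. Qed.

Lemma log_bound_poly_degree (R : realType) (eps : R) (f : forall n, boolfun n) :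
  0 < eps -> (forall n, majority_one (f n)) ->
  (forall C : R, 0 < C -> \forall n \near \oo,
     disperser (n%:R `^ eps) +oo%E
       (2 `^ (n%:R - C * n%:R / log2 (log2 n%:R))) (f n)) ->
  log_superlinear R f.
Proof.
move=> eps0 mf df c; set c' := 1 + `|c|.
have c1 : 1 <= c' by rewrite /c'; have := normr_ge0 c; lra.
(* A block of constant length [r]: deleting it divides the number of levels, at most [2 * c' * Lg],
   by [2 ^ r]. At most [eps * Lg] levels remain, which keeps the degree at most [n] to the power
   [eps]. *)
have [r r0] := exists_natr_gt (2 * c' / eps); rewrite ltr_pdivrMr // => rP'.
have rP : 2 * c' <= (2 ^ r)%:R * eps.
  apply: le_trans (ltW rP') _; rewrite ler_pM2r // ler_nat.
  exact: ltnW (ltn_expl _ _).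
(* After multiplication by [LL], the nodes of [B] cost at most [4 * r%:R * c' * n%:R] and the
   additional bit at most [4 * n%:R]; one more unit gives the contradiction. *)
pose C0 := 4 * r%:R * c' + 5.
near=> n; move=> [C [Cf sC dC]].
(* Ensures [2 * r <= k], so that the rounding in [k %/ r] loses at most a factor 2. *)
have lg1 : (2 ^ (2 * r))%:R < log2 (n%:R : R).
  by near: n; apply: near_log2_gt.
have lg2 : 2 < log2 (n%:R : R) by near: n; apply: near_log2_gt.
have nN0 : (0 < n)%N by near: n; exact: nbhs_infty_gt.
have n0 : 0 < n%:R :> R by rewrite ltr0n.
have d : disperser (n%:R `^ eps) +oo%E
    (2 `^ (n%:R - C0 * n%:R / log2 (log2 n%:R))) (f n).
  by near: n; apply: df; rewrite /C0; have := ler0n R r; nra.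
set Lg := log2 n%:R in lg1 lg2 d dC.
have [||k [l [l_lt lk k2 k1]]] := @depth_levels R n C (c' * Lg).
- by nra.
- by apply: depth_le_norm dC; apply: lt_trans lg2; lra.
have Lgk : Lg < (2 ^ k)%:R by apply: le_lt_trans k1; nra.
have rk : (2 * r <= k)%N.
  rewrite leqNgt; apply/negP => lt.
  have : (2 ^ k)%:R <= (2 ^ (2 * r))%:R :> R by rewrite ler_nat leq_exp2l // ltnW.
  by lra.
have rk' : (r <= k)%N := leq_trans (leq_pmull r (isT : 0 < 2)%N) rk.
have q0 : (0 < k %/ r)%N by rewrite divn_gt0.
have [B [psi [psi_lt psi_le cB]]] := valiant_cut q0 (leq_divM k r) l_lt lk.
have := guess_disperser Cf (mf n) psi_lt psi_le _ (leey _) d.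
have -> : (2 ^ 2 ^ (k - r))%:R <= n%:R `^ eps :> R.
  rewrite natrX -ler_ln ?posrE ?powR_gt0 ?exprn_gt0 ?ltr0n //.
  rewrite ln_exprn ?ltr0n // ln_powR.
  have -> : ln n%:R = Lg * ln (2 : R).
    by rewrite /Lg /log2 divfK // gt_eqF // ln2_gt0.
  rewrite mulrA ler_pM2r ?ln2_gt0 //.
  have pr0 : 0 < (2 ^ r)%:R :> R by rewrite ltr0n expn_gt0.
  rewrite -(ler_pM2r pr0) -natrM -expnD subnK //.
  by apply: le_trans k2 _; nra.
move=> /(_ isT); set LL := log2 Lg.
have LLk : LL <= k%:R.
  rewrite /LL /log2 ler_pdivrMr ?ln2_gt0 // -ln_exprn ?ltr0n //.
  by rewrite ler_ln ?posrE ?exprn_gt0 ?ltr0n //; [rewrite -natrX ltW|lra].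
have LL0 : 0 < LL.
  rewrite /LL /log2 divr_gt0 ?ln2_gt0 // ln_gt0 //; lra.
have Bk : #|B|%:R * LL <= 4 * r%:R * c' * n%:R.
  have h1 : #|B|%:R * LL <= #|B|%:R * k%:R by apply: ler_wpM2l => //; exact: ler0n.
  have h2 : #|B|%:R * k%:R <= 4 * r%:R * (csize C)%:R :> R.
    by rewrite -!natrM ler_nat (leq_cut_product (leq_double_divM r0 rk)).
  have h3 := size_le_norm sC; rewrite -/c' in h3.
  have h4 : 4 * r%:R * (csize C)%:R <= 4 * r%:R * (c' * n%:R).
    by apply: ler_wpM2l => //; rewrite mulr_ge0 ?ler0n.
  by rewrite -mulrA; lra.
have LLn : LL <= 4 * n%:R.
  have : LL <= 2 * Lg by apply: log2_le; lra.
  have : Lg <= 2 * n%:R by apply: log2_le.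
  by lra.
rewrite -natr1 => bad.
have {}bad : C0 * n%:R / LL <= #|B|%:R + 1 by lra.
by move: bad; rewrite ler_pdivrMr // /C0; lra.
Unshelve. all: by end_near. Qed.

Lemma log_bound_subpoly_degree (R : realType) (eps : R) (f : forall n, boolfun n) :
  0 < eps -> (forall n, majority_one (f n)) ->
  (forall eta : R, 0 < eta -> \forall n \near \oo,
     disperser (2 `^ (log2 n%:R `^ (1 - eta))) +oo%E
       (2 `^ ((1 - eps) * n%:R)) (f n)) ->
  log_superlinear R f.
Proof.
move=> eps0 mf df c; set c' := 1 + `|c|.
have c1 : 1 <= c' by rewrite /c'; have := normr_ge0 c; lra.
(* Here the number [q] of blocks is constant and their length grows with [k]; guessing at most a
   fraction [2 / q] of the gates costs at most [eps / 2 * n%:R]. *)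
have [q qN0] := exists_natr_gt (4 * c' / eps); rewrite ltr_pdivrMr // => qP.
have q0 : 0 < q%:R :> R by rewrite ltr0n.
(* Half of the saving of [1 / q] in the exponent; the other half absorbs the constant [4 * c'] once
   [Lg] to the power [eta] exceeds it. *)
pose eta : R := 1 / (2 * q%:R).
have eta0 : 0 < eta by rewrite divr_gt0 // mulr_gt0.
have etaq : eta * q%:R = 1 / 2 by rewrite /eta; field; rewrite gt_eqF.
near=> n; move=> [C [Cf sC dC]].
have lg1 : expR (ln (4 * c') * (2 * q%:R)) < log2 (n%:R : R).
  by near: n; apply: near_log2_gt.
have lg2 : 2 < log2 (n%:R : R) by near: n; apply: near_log2_gt.
have n0 : 2 < eps * n%:R.
  rewrite mulrC -ltr_pdivrMr //; near: n; exact: nbhs_infty_gtr.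
have d : disperser (2 `^ (log2 n%:R `^ (1 - eta))) +oo%E
    (2 `^ ((1 - eps) * n%:R)) (f n).
  by near: n; apply: df.
set Lg := log2 n%:R in lg1 lg2 d dC.
have [||k [l [l_lt lk k2 k1]]] := @depth_levels R n C (c' * Lg).
- by nra.
- by apply: depth_le_norm dC; apply: lt_trans lg2; lra.
pose r := (k %/ q)%N.
have qr : (q * r <= k)%N by rewrite mulnC leq_divM.
have [B [psi [psi_lt psi_le cB]]] := valiant_cut qN0 qr l_lt lk.
have := guess_disperser Cf (mf n) psi_lt psi_le _ (leey _) d.
have l2 := ln2_gt0 R.
have -> : (2 ^ 2 ^ (k - r))%:R <= 2 `^ (Lg `^ (1 - eta)) :> R.
  rewrite natrX -powR_mulrn ?ler0n //; apply: ler_powR; first by lra.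
  rewrite natrX -ler_ln ?posrE ?powR_gt0 ?exprn_gt0 ?ltr0n //; last by lra.
  rewrite ln_exprn ?ltr0n // ln_powR natrB; last exact: leq_div.
  have lnL : ln (4 * c') * (2 * q%:R) <= ln Lg.
    rewrite -ler_expR lnK ?posrE; [exact: ltW|lra].
  have {}k2 : k%:R * ln 2 <= ln (2 * c') + ln Lg.
    rewrite -lnM ?posrE; [|lra|lra].
    rewrite -ln_exprn ?ltr0n // ler_ln ?posrE ?exprn_gt0 ?ltr0n //.
      by rewrite -natrX -mulrA.
    by nra.
  have rk : k%:R <= q%:R * (r%:R + 1) :> R.
    by rewrite natr1 -natrM ler_nat ltnW // mulnC ltn_ceil.
  have l4 : ln (4 * c') = ln 2 + ln (2 * c').
    by rewrite -lnM ?posrE; [congr ln; lra|lra|lra].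
  have l2c : 0 <= ln (2 * c') by apply: ln_ge0; lra.
  have lL : ln (4 * c') <= eta * ln Lg.
    have e1 : ln (4 * c') = eta * (ln (4 * c') * (2 * q%:R)).
      have -> : eta * (ln (4 * c') * (2 * q%:R)) = ln (4 * c') * (2 * (eta * q%:R)).
        by ring.
      by rewrite etaq; lra.
    by rewrite e1; apply: ler_wpM2l => //; apply: ltW.
  have iq : 2 * eta * k%:R <= r%:R + 1.
    have : 2 * eta * k%:R <= 2 * eta * (q%:R * (r%:R + 1)).
      by apply: ler_wpM2l => //; lra.
    have -> : 2 * eta * (q%:R * (r%:R + 1)) = 2 * (eta * q%:R) * (r%:R + 1) by ring.
    by rewrite etaq; lra.
  have eta2 : 2 * eta <= 1.
    by have q1 : 1 <= q%:R :> R; [rewrite ler1n|nra].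
  have h1 : (k%:R - r%:R) * ln 2 <= (k%:R * (1 - 2 * eta) + 1) * ln (2 : R).
    by apply: ler_wpM2r; lra.
  have h2 : (1 - 2 * eta) * (k%:R * ln 2) <= (1 - 2 * eta) * (ln (2 * c') + ln Lg).
    by apply: ler_wpM2l; lra.
  have h3 : (1 - 2 * eta) * ln (2 * c') <= ln (2 * c').
    by rewrite -[leRHS]mul1r; apply: ler_wpM2r; lra.
  by lra.
move=> /(_ isT).
have Bsmall : #|B|%:R <= eps / 2 * n%:R.
  have h1 : q%:R * #|B|%:R <= 2 * (csize C)%:R :> R by rewrite -!natrM ler_nat.
  have h3 := size_le_norm sC; rewrite -/c' in h3.
  rewrite -(ler_pM2l q0); apply: le_trans h1 _.
  have : 4 * c' * n%:R <= q%:R * eps * n%:R.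
    by apply: ler_wpM2r; [exact: ler0n|exact: ltW].
  by lra.
by rewrite -natr1; lra.
Unshelve. all: by end_near. Qed.

Theorem theorem11 (R : realType) (eps : R) (eps_gt0 : 0 < eps) :
  [/\ (forall (n : nat) (f : boolfun n), majority_one f ->
         disperser 16 (13 / 10 * (1 - eps) * n%:R)%:E (2 `^ (eps * n%:R)) f ->
         ((39 / 10 * (1 - eps) * n%:R - 4)%:E <= circuit_complexity R f)%E),
      (forall f : (forall n : nat, boolfun n),
         (forall n : nat, majority_one (f n)) ->
         (forall (k : nat) (C : R), 0 < C -> \forall n \near \oo,
            disperser k%:R (C * n%:R)%:E (2 `^ ((1 - eps) * n%:R)) (f n)) ->
         sp_superlinear R f),
      (forall f : (forall n : nat, boolfun n),
         (forall n : nat, majority_one (f n)) ->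
         (forall eta : R, 0 < eta -> \forall n \near \oo,
            disperser (2 `^ (log2 n%:R `^ (1 - eta))) +oo%E
              (2 `^ ((1 - eps) * n%:R)) (f n)) ->
         log_superlinear R f)
    & (forall f : (forall n : nat, boolfun n),
         (forall n : nat, majority_one (f n)) ->
         (forall C : R, 0 < C -> \forall n \near \oo,
            disperser (n%:R `^ eps) +oo%E
              (2 `^ (n%:R - C * n%:R / log2 (log2 n%:R))) (f n)) ->
         log_superlinear R f)].
Proof.
split=> [n f|f|f|f].
- exact: size_lower_bound.
- exact: sp_bound.
- exact: log_bound_subpoly_degree.
- exact: log_bound_poly_degree.
Qed.
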